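(* Let $m$ be a positive integer and $-\frac\pi2<x<\frac\pi2$. Then $$\sum_{n=1}^\infty\frac{(-1)^{n-1}\sin(2n-1)x}{(2n-1)^{2m-1}}=\frac{(-1)^{m-1}(2\pi)^{2m-2}}{2(2m-2)!}\Big(\zeta'\Big(2-2m,\tfrac14-\tfrac x{2\pi}\Big)-\zeta'\Big(2-2m,\tfrac34-\tfrac x{2\pi}\Big)-\zeta'\Big(2-2m,\tfrac14+\tfrac x{2\pi}\Big)+\zeta'\Big(2-2m,\tfrac34+\tfrac x{2\pi}\Big)\Big).$$
   Context: For $0<a\le 1$ (more generally $a>0$), $\zeta(s,a)$ denotes the Hurwitz zeta function, defined for $\Re s>1$ by $\zeta(s,a)=\sum_{k=0}^\infty (k+a)^{-s}$ and extended by analytic continuation to all complex $s\neq 1$. Throughout, $\zeta'(s,a)$ denotes the partial derivative $\frac{\partial}{\partial s}\zeta(s,a)$ with respect to the first variable $s$. *)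

(* Defs.v *)
From Stdlib Require Import Reals ClassicalEpsilon.
From Coquelicot Require Import Coquelicot.
Open Scope R_scope.

Definition real_analytic (F : R -> R) : Prop :=
  forall x0 : R, exists r : R, 0 < r /\ exists c : nat -> R,
    forall x : R, Rabs (x - x0) < r -> is_pseries c (x - x0) (F x).

(* Z is (the restriction to real s <> 1 of) the Hurwitz zeta function zeta(s,a):
   Z(s) = sum_{k>=0} (k+a)^(-s) for s > 1, and (s-1) Z(s) extends to a real
   analytic function on R (the restriction of the entire function
   (s-1) zeta(s,a)).  By the identity theorem this determines Z(s) for all
   real s <> 1, i.e. it is exactly the analytic continuation. *)
Definition hurwitz_cont (a : R) (Z : R -> R) : Prop :=
  exists F : R -> R, real_analytic F /\
    (forall s, 1 < s -> is_series (fun k : nat => Rpower (INR k + a) (- s)) (Z s)) /\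
    (forall s, s <> 1 -> F s = (s - 1) * Z s).

(* Hurwitz zeta function zeta(s,a) for real s <> 1 (value at s = 1 irrelevant). *)
Definition hurwitz_zeta (a : R) : R -> R :=
  epsilon (inhabits (fun _ : R => 0)) (hurwitz_cont a).

Definition hurwitz_zeta' (s a : R) : R := Derive (hurwitz_zeta a) s.

(* Main.v *)
Require Import Defs.
From Stdlib Require Import Reals Lra Lia Factorial ClassicalEpsilon.
From Coquelicot Require Import Coquelicot.
Open Scope R_scope.

(* Let Psi(s, a) = (s - 1) (zeta(s, a) + zeta(s, 1 - a)), which is invariant
   under a -> 1 - a.  Continuing the corresponding identities from s > 1 gives
   Psi_aa(s, a) = s (s - 1) Psi(s + 2, a) and the duplication formula
   Psi(s, a) + Psi(s, a + 1/2) = 2^s Psi(s, 2 a).  At s = - 2 k, induction on k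
   shows that Psi(- 2 k, .) is affine, constant by symmetry, and zero by
   duplication.  The same scheme identifies Psi_s(- 2 k, a) with
   - (-1)^k (2 k + 1)! (2 pi)^(- 2 k) sum_n cos(2 pi n a) / n^(2 k + 1): the second
   derivatives in a of both sides satisfy the same recursion in k, and
   duplication removes the integration constant.  For k = 0 both sides equal
   ln(2 sin(pi a)), by Herglotz' trick for
   sum_n (n + a)^(-2) = pi^2 / sin(pi a)^2 on one side and the Dirichlet kernel
   on the other.  The theorem is the difference of this identity at
   a = 1/4 - x / (2 pi) and a = 1/4 + x / (2 pi).

   Analyticity in s and differentiability in a come together from bounding
   Taylor remainders in a by explicit majorants in the algebra of absolutely
   convergent power series in s. *)

(** Everything happens at real [s], so contour arguments give way to the identity theorem on half
    lines and to a coefficient norm that bounds a function and its [s]-derivative at once. A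
    remainder in [a] of norm O(y^2) can thus be differentiated in [s] without interchanging mixed
    partial derivatives. The factor s - 1 removes the pole, so formulas linking s, s + 1 and s + 2
    may pass through 1. The [s]-derivative of s (s - 1) Psi(s + 2, a) contains the extra term (2 s -
    1) Psi(s + 2, a). It vanishes at s = - 2 k for k > 0; at s = 0 it is the only term left, and -
    pi^2 / sin(pi a)^2 is the second derivative of ln(sin(pi a)). For k = 0 the cosine series
    converges only conditionally, so only partial sums are differentiated: the error at level k + 1
    has as second derivative a multiple of the error at level k, and two integrations from a = 1/2,
    where first derivatives vanish by symmetry, preserve locally uniform convergence. The factor (2
    k + 1)! (2 pi)^(- 2 k) accumulates the ratios (2 k + 2) (2 k + 3) / (2 pi)^2. *)

(** * Real series: dominated convergence and interchange of sums *)

Lemma is_series_lim (a : nat -> R) (l : R) :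
  is_series a l <-> is_lim_seq (fun n => sum_f_R0 a n) l.
Proof.
  split; intros H.
  - apply is_lim_seq_ext with (sum_n a); [intros n; apply sum_n_Reals|]; exact H.
  - assert (H' : is_lim_seq (sum_n a) l).
    { apply is_lim_seq_ext with (2 := H); intros n; symmetry; apply sum_n_Reals. }
    exact H'.
Qed.

Lemma is_lim_seq_Series (a : nat -> R) :
  ex_series a -> is_lim_seq (fun n => sum_f_R0 a n) (Series a).
Proof. intros H; apply is_series_lim, Series_correct, H. Qed.

Lemma ex_series_le_R (a b : nat -> R) :
  (forall n, Rabs (a n) <= b n) -> ex_series b -> ex_series a.
Proof. intros H Hb; exact (ex_series_le (V := R_CompleteNormedModule) a b H Hb). Qed.

Lemma ex_series_Rabs_le (a b : nat -> R) :
  (forall n, Rabs (a n) <= b n) -> ex_series b -> ex_series (fun n => Rabs (a n)).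
Proof.
  intros H Hb; apply ex_series_le_R with b; auto; intros n; rewrite Rabs_Rabsolu; auto.
Qed.

Lemma Series_abs_le (a b : nat -> R) :
  (forall n, Rabs (a n) <= b n) -> ex_series b -> Rabs (Series a) <= Series b.
Proof.
  intros H Hb.
  apply Rle_trans with (Series (fun n => Rabs (a n))).
  - apply Series_Rabs, ex_series_Rabs_le with b; auto.
  - apply Series_le; auto; intros n; split; auto; apply Rabs_pos.
Qed.

Lemma ex_series_bounded_pos (a : nat -> R) (C : R) :
  (forall n, 0 <= a n) -> (forall n, sum_f_R0 a n <= C) -> ex_series a.
Proof.
  intros Ha HC.
  destruct (ex_finite_lim_seq_incr (fun n => sum_f_R0 a n) C) as [l Hl]; auto.
  - intros n; simpl; specialize (Ha (S n)); lra.
  - exists l; apply is_series_lim; exact Hl.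
Qed.

Lemma sum_le_Series (a : nat -> R) (n : nat) :
  (forall n, 0 <= a n) -> ex_series a -> sum_f_R0 a n <= Series a.
Proof.
  intros Ha Hex.
  refine (is_lim_seq_incr_compare (fun n => sum_f_R0 a n) _ (is_lim_seq_Series a Hex) _ n).
  intros k; simpl; specialize (Ha (S k)); lra.
Qed.

Lemma Series_le_bound (a : nat -> R) (C : R) :
  ex_series a -> (forall n, sum_f_R0 a n <= C) -> Series a <= C.
Proof.
  intros Hex H.
  exact (is_lim_seq_le _ _ _ _ H (is_lim_seq_Series a Hex) (is_lim_seq_const C)).
Qed.

Lemma series_tail_small (C : nat -> R) :
  (forall n, 0 <= C n) -> ex_series C ->
  forall eps, 0 < eps -> exists N, Series (fun k => C (S N + k)%nat) < eps.
Proof.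
  intros HC Hex eps He.
  pose proof (is_lim_seq_Series C Hex) as H.
  apply is_lim_seq_Reals in H.
  destruct (H eps He) as [N HN]; exists N.
  specialize (HN N (le_n N)); unfold Rdist in HN.
  pose proof (Series_incr_n C (S N) ltac:(lia) Hex) as E.
  simpl pred in E; rewrite Rabs_minus_sym in HN.
  apply Rabs_def2 in HN; lra.
Qed.

(** Tannery's theorem: beyond a cut-off [N] the tails of [d J] and of [l] are each below eps / 4 by
    domination, and the finitely many terms up to [N] converge. *)
Lemma is_lim_seq_Series_dominated (d : nat -> nat -> R) (l C : nat -> R) :
  (forall J n, Rabs (d J n) <= C n) -> ex_series C ->
  (forall n, is_lim_seq (fun J => d J n) (l n)) ->
  is_lim_seq (fun J => Series (d J)) (Series l).
Proof.
  intros Hd HC Hl.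
  assert (HC0 : forall n, 0 <= C n).
  { intros n; apply Rle_trans with (2 := Hd 0%nat n); apply Rabs_pos. }
  assert (Hlb : forall n, Rabs (l n) <= C n).
  { intros n.
    exact (is_lim_seq_le _ _ (Rabs (l n)) _ (fun J => Hd J n)
      (is_lim_seq_abs _ (l n) (Hl n)) (is_lim_seq_const (C n))). }
  apply is_lim_seq_Reals; intros eps He.
  destruct (series_tail_small C HC0 HC (eps / 4) ltac:(lra)) as [N HN].
  assert (Hfin : is_lim_seq (fun J => sum_f_R0 (d J) N) (sum_f_R0 l N)).
  { clear HN; induction N as [|N IH]; simpl; auto.
    apply is_lim_seq_plus'; auto. }
  apply is_lim_seq_Reals in Hfin.
  destruct (Hfin (eps / 2) ltac:(lra)) as [J0 HJ0]; exists J0; intros J HJ.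
  specialize (HJ0 J HJ); unfold Rdist in *.
  assert (HexC : ex_series (fun k => C (S N + k)%nat)).
  { apply (ex_series_incr_n C (S N)); auto. }
  rewrite (Series_incr_n (d J) (S N)); [|lia|apply ex_series_le_R with C; auto].
  rewrite (Series_incr_n l (S N)); [|lia|apply ex_series_le_R with C; auto].
  simpl pred.
  pose proof (Series_abs_le (fun k => d J (S N + k)%nat) _ (fun k => Hd J _) HexC) as H1.
  pose proof (Series_abs_le (fun k => l (S N + k)%nat) _ (fun k => Hlb _) HexC) as H2.
  apply Rabs_def2 in HJ0; apply Rabs_le_between in H1; apply Rabs_le_between in H2.
  apply Rabs_def1; lra.
Qed.

Lemma Series_sum_swap (a : nat -> nat -> R) (J : nat) :
  (forall j, ex_series (fun n => a n j)) ->
  ex_series (fun n => sum_f_R0 (a n) J) /\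
  Series (fun n => sum_f_R0 (a n) J) = sum_f_R0 (fun j => Series (fun n => a n j)) J.
Proof.
  intros H; induction J as [|J [IH1 IH2]]; simpl; auto.
  split; [apply (ex_series_plus (V := R_NormedModule)); auto|].
  rewrite Series_plus; auto; rewrite IH2; auto.
Qed.

(** Dominated convergence applied to the partial sums in [j], each of which commutes with the sum
    over [n] because it is finite. *)
Lemma is_series_fubini (a : nat -> nat -> R) (C : nat -> R) :
  (forall n J, sum_f_R0 (fun j => Rabs (a n j)) J <= C n) -> ex_series C ->
  is_series (fun j => Series (fun n => a n j)) (Series (fun n => Series (a n))).
Proof.
  intros Ha HC.
  assert (Hj : forall j n, Rabs (a n j) <= C n).
  { intros j n; apply Rle_trans with (2 := Ha n j).
    destruct j as [|j]; simpl; [lra|].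
    pose proof (cond_pos_sum (fun j => Rabs (a n j)) j (fun k => Rabs_pos _)); lra. }
  assert (Hex : forall j, ex_series (fun n => a n j)).
  { intros j; apply ex_series_le_R with C; auto. }
  apply is_series_lim.
  apply is_lim_seq_ext with (fun J => Series (fun n => sum_f_R0 (a n) J)).
  { intros J; apply Series_sum_swap; auto. }
  apply is_lim_seq_Series_dominated with (d := fun J n => sum_f_R0 (a n) J) (C := C); auto.
  - intros J n; apply Rle_trans with (2 := Ha n J); apply Rsum_abs.
  - intros n; apply is_lim_seq_Series, ex_series_Rabs, ex_series_bounded_pos with (C n); auto.
    intros; apply Rabs_pos.
Qed.

(** * The Wiener algebra of absolutely convergent power series *)

(* The norm of the Wiener algebra of power series converging absolutely on
   the closed disc of radius [rho] around [s0] is at most [C]. *)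
Definition wiener (s0 rho : R) (f : R -> R) (C : R) : Prop :=
  exists c : nat -> R,
    (forall n, sum_f_R0 (fun j => Rabs (c j) * rho ^ j) n <= C) /\
    forall s, Rabs (s - s0) <= rho -> is_series (fun j => c j * (s - s0) ^ j) (f s).

Lemma wiener_le s0 rho f C C' : C <= C' -> wiener s0 rho f C -> wiener s0 rho f C'.
Proof.
  intros H [c [H1 H2]]; exists c; split; auto.
  intros n; apply Rle_trans with C; auto.
Qed.

Lemma wiener_shrink s0 rho rho' f C :
  0 <= rho' <= rho -> wiener s0 rho f C -> wiener s0 rho' f C.
Proof.
  intros H [c [H1 H2]]; exists c; split.
  - intros n; apply Rle_trans with (2 := H1 n); apply sum_Rle; intros j _.
    apply Rmult_le_compat_l; [apply Rabs_pos|apply pow_incr; auto].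
  - intros s Hs; apply H2; lra.
Qed.

Lemma wiener_ext s0 rho f g C :
  (forall s, Rabs (s - s0) <= rho -> f s = g s) -> wiener s0 rho f C -> wiener s0 rho g C.
Proof.
  intros H [c [H1 H2]]; exists c; split; auto.
  intros s Hs; rewrite <- H; auto.
Qed.

Lemma wiener_ext_all s0 rho f g C :
  (forall s, f s = g s) -> wiener s0 rho f C -> wiener s0 rho g C.
Proof. intros H; apply wiener_ext; auto. Qed.

Lemma wiener_pos s0 rho f C : wiener s0 rho f C -> 0 <= C.
Proof.
  intros [c [H1 _]]; specialize (H1 O); simpl in H1.
  pose proof (Rabs_pos (c O)); lra.
Qed.

Lemma is_series_finite (a : nat -> R) (n : nat) :
  (forall k, (n < k)%nat -> a k = 0) -> is_series a (sum_f_R0 a n).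
Proof.
  intros H; apply is_series_lim.
  apply is_lim_seq_ext_loc with (fun _ => sum_f_R0 a n); [|apply is_lim_seq_const].
  exists n; intros k Hk; induction Hk as [|k Hk IH]; auto.
  simpl; rewrite <- IH, H; [lra|lia].
Qed.

Lemma sum_finite_stop (a : nat -> R) (n k : nat) :
  (forall k, (n < k)%nat -> a k = 0) -> (n <= k)%nat -> sum_f_R0 a k = sum_f_R0 a n.
Proof.
  intros H Hk; induction Hk as [|k Hk IH]; auto.
  simpl; rewrite IH, H; [lra|lia].
Qed.

Lemma wiener_lin s0 rho b d :
  0 <= rho -> wiener s0 rho (fun s => b + d * s) (Rabs (b + d * s0) + Rabs d * rho).
Proof.
  intros Hr.
  set (c := fun j => match j with O => b + d * s0 | S O => d | _ => 0 end).
  assert (Hc : forall k, (1 < k)%nat -> c k = 0).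
  { intros [|[|k]] Hk; try lia; reflexivity. }
  exists c; split.
  - intros n.
    pose proof (Rmult_le_pos _ _ (Rabs_pos d) Hr) as Hp.
    destruct n as [|n]; [simpl; lra|].
    rewrite (sum_finite_stop _ 1); [simpl; lra| |lia].
    intros k Hk; rewrite Hc, Rabs_R0; auto; lra.
  - intros s _.
    replace (b + d * s) with (sum_f_R0 (fun j => c j * (s - s0) ^ j) 1) by (simpl; ring).
    apply is_series_finite; intros k Hk; rewrite Hc; auto; lra.
Qed.

Lemma wiener_plus s0 rho f g C D :
  wiener s0 rho f C -> wiener s0 rho g D -> 0 <= rho ->
  wiener s0 rho (fun s => f s + g s) (C + D).
Proof.
  intros [c [H1 H2]] [d [H3 H4]] Hr; exists (fun j => c j + d j); split.
  - intros n; specialize (H1 n); specialize (H3 n).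
    apply Rle_trans with (sum_f_R0 (fun j => Rabs (c j) * rho ^ j + Rabs (d j) * rho ^ j) n).
    + apply sum_Rle; intros j _; rewrite <- Rmult_plus_distr_r.
      apply Rmult_le_compat_r; [apply pow_le; auto|apply Rabs_triang].
    + rewrite sum_plus; lra.
  - intros s Hs.
    apply is_series_ext with (fun j => plus (c j * (s - s0) ^ j) (d j * (s - s0) ^ j)).
    { intros j; unfold plus; simpl; ring. }
    apply (is_series_plus (V := R_NormedModule)); auto.
Qed.

(** Submultiplicativity of the norm: the Cauchy product of the coefficients is dominated termwise by
    the Cauchy product [w] of the two norm series, whose sum is at most C D. *)
Lemma wiener_mult s0 rho f g C D :
  wiener s0 rho f C -> wiener s0 rho g D -> 0 <= rho ->
  wiener s0 rho (fun s => f s * g s) (C * D).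
Proof.
  intros Hf Hg Hr.
  pose proof (wiener_pos _ _ _ _ Hf) as HC; pose proof (wiener_pos _ _ _ _ Hg) as HD.
  destruct Hf as [c [H1 H2]]; destruct Hg as [d [H3 H4]].
  set (u := fun j => Rabs (c j) * rho ^ j).
  set (v := fun j => Rabs (d j) * rho ^ j).
  assert (Hu0 : forall j, 0 <= u j).
  { intros j; apply Rmult_le_pos; [apply Rabs_pos|apply pow_le; auto]. }
  assert (Hv0 : forall j, 0 <= v j).
  { intros j; apply Rmult_le_pos; [apply Rabs_pos|apply pow_le; auto]. }
  assert (Hu : ex_series u) by (apply ex_series_bounded_pos with C; auto).
  assert (Hv : ex_series v) by (apply ex_series_bounded_pos with D; auto).
  assert (abs_ex : forall w : nat -> R, (forall j, 0 <= w j) -> ex_series w ->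
    ex_series (fun j => Rabs (w j))).
  { intros w Hw; apply ex_series_Rabs_le; intros j; rewrite Rabs_pos_eq; auto; lra. }
  set (e := fun n => sum_f_R0 (fun k => c k * d (n - k)%nat) n).
  assert (split_pow : forall (p q : nat -> R) t n,
    sum_f_R0 (fun k => p k * t ^ k * (q (n - k)%nat * t ^ (n - k))) n =
    sum_f_R0 (fun k => p k * q (n - k)%nat) n * t ^ n).
  { intros p q t n; rewrite Rmult_comm, scal_sum; apply sum_eq; intros k Hk.
    replace (t ^ n) with (t ^ k * t ^ (n - k)) by (rewrite <- pow_add; f_equal; lia).
    ring. }
  exists e; split.
  - intros n.
    apply Rle_trans with (Series u * Series v).
    2:{ apply Rmult_le_compat.
        - apply Rle_trans with (sum_f_R0 u 0); [apply Hu0|apply sum_le_Series; auto].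
        - apply Rle_trans with (sum_f_R0 v 0); [apply Hv0|apply sum_le_Series; auto].
        - apply Series_le_bound; auto.
        - apply Series_le_bound; auto. }
    set (w := fun n => sum_f_R0 (fun k => u k * v (n - k)%nat) n).
    assert (Hw : is_series w (Series u * Series v)).
    { apply is_series_mult; auto using Series_correct. }
    apply Rle_trans with (sum_f_R0 w n).
    + apply sum_Rle; intros j _; unfold w, u, v, e.
      rewrite (split_pow (fun k => Rabs (c k)) (fun k => Rabs (d k))).
      apply Rmult_le_compat_r; [apply pow_le; auto|].
      apply Rle_trans with (1 := Rsum_abs _ _); right; apply sum_eq; intros k _.
      apply Rabs_mult.
    + rewrite <- (is_series_unique w _ Hw); apply sum_le_Series.
      * intros k; apply cond_pos_sum; intros i; apply Rmult_le_pos; auto.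
      * eexists; apply Hw.
  - intros s Hs.
    apply is_series_ext with
      (fun n => sum_f_R0 (fun k => c k * (s - s0) ^ k * (d (n - k)%nat * (s - s0) ^ (n - k))) n).
    { intros n; apply split_pow. }
    assert (dom : forall p j, Rabs (p * (s - s0) ^ j) <= Rabs p * rho ^ j).
    { intros p j; rewrite Rabs_mult; apply Rmult_le_compat_l; [apply Rabs_pos|].
      rewrite <- RPow_abs; apply pow_incr; split; [apply Rabs_pos|auto]. }
    apply (is_series_mult (fun k => c k * (s - s0) ^ k) (fun k => d k * (s - s0) ^ k)); auto.
    + apply ex_series_Rabs_le with u; auto; intros j; apply dom.
    + apply ex_series_Rabs_le with v; auto; intros j; apply dom.
Qed.

(** Completeness of the algebra: an absolutely convergent series of elements is summed coefficient
    by coefficient, and the double series is rearranged by [is_series_fubini]. *)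
Lemma wiener_series s0 rho (f : nat -> R -> R) (C : nat -> R) :
  0 <= rho -> (forall n, wiener s0 rho (f n) (C n)) -> ex_series C ->
  wiener s0 rho (fun s => Series (fun n => f n s)) (Series C).
Proof.
  intros Hr Hf HC.
  (* One coefficient sequence is chosen for every [n], so that coefficients of equal index can be
     summed over [n]. *)
  set (c := fun n => proj1_sig (constructive_indefinite_description _ (Hf n))).
  assert (Hc : forall n,
    (forall k, sum_f_R0 (fun j => Rabs (c n j) * rho ^ j) k <= C n) /\
    forall s, Rabs (s - s0) <= rho -> is_series (fun j => c n j * (s - s0) ^ j) (f n s)).
  { intros n; unfold c; destruct (constructive_indefinite_description _ _); auto. }
  clearbody c.
  assert (Hcn : forall j n, Rabs (Rabs (c n j) * rho ^ j) <= C n).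
  { intros j n; destruct (Hc n) as [H _].
    assert (P : forall j, 0 <= Rabs (c n j) * rho ^ j).
    { intros i; apply Rmult_le_pos; [apply Rabs_pos|apply pow_le; auto]. }
    rewrite Rabs_pos_eq; auto.
    apply Rle_trans with (2 := H j); destruct j as [|j]; simpl; [lra|].
    pose proof (cond_pos_sum (fun j => Rabs (c n j) * rho ^ j) j P); lra. }
  assert (Hexa : forall j, ex_series (fun n => Rabs (c n j) * rho ^ j)).
  { intros j; apply ex_series_le_R with C; auto. }
  exists (fun j => Series (fun n => c n j)); split.
  - intros J.
    apply Rle_trans with (sum_f_R0 (fun j => Series (fun n => Rabs (c n j) * rho ^ j)) J).
    + apply sum_Rle; intros j _.
      rewrite <- (Rabs_pos_eq (rho ^ j)) at 1 by (apply pow_le; auto).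
      rewrite <- Rabs_mult, <- Series_scal_r.
      apply Series_abs_le; auto; intros n.
      rewrite Rabs_mult, (Rabs_pos_eq (rho ^ j)) by (apply pow_le; auto); lra.
    + rewrite <- (proj2 (Series_sum_swap (fun n j => Rabs (c n j) * rho ^ j) J Hexa)).
      apply Series_le; auto; intros n; split; [|apply Hc].
      apply cond_pos_sum; intros i; apply Rmult_le_pos; [apply Rabs_pos|apply pow_le; auto].
  - intros s Hs.
    assert (E : Series (fun n => f n s) = Series (fun n => Series (fun j => c n j * (s - s0) ^ j))).
    { apply Series_ext; intros n; symmetry; apply is_series_unique, Hc, Hs. }
    rewrite E.
    apply is_series_ext with (fun j => Series (fun n => c n j * (s - s0) ^ j)).
    { intros j; apply Series_scal_r. }
    apply is_series_fubini with C; auto.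
    intros n J; apply Rle_trans with (2 := proj1 (Hc n) J); apply sum_Rle; intros j _.
    rewrite Rabs_mult; apply Rmult_le_compat_l; [apply Rabs_pos|].
    rewrite <- RPow_abs; apply pow_incr; split; [apply Rabs_pos|auto].
Qed.

Lemma wiener_term_le s0 rho f C s :
  0 <= rho -> wiener s0 rho f C -> Rabs (s - s0) <= rho -> Rabs (f s) <= C.
Proof.
  intros Hr [c [H1 H2]] Hs.
  rewrite <- (is_series_unique _ _ (H2 s Hs)).
  assert (P : forall j, 0 <= Rabs (c j) * rho ^ j).
  { intros i; apply Rmult_le_pos; [apply Rabs_pos|apply pow_le; auto]. }
  assert (Hex : ex_series (fun j => Rabs (c j) * rho ^ j))
    by (apply ex_series_bounded_pos with C; auto).
  apply Rle_trans with (Series (fun j => Rabs (c j) * rho ^ j)).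
  - apply Series_abs_le; auto; intros j; rewrite Rabs_mult.
    apply Rmult_le_compat_l; [apply Rabs_pos|].
    rewrite <- RPow_abs; apply pow_incr; split; [apply Rabs_pos|auto].
  - apply Series_le_bound; auto.
Qed.

(** At a point [q] strictly between |t| and r the terms c_j q^j tend to 0, hence are bounded, and
    the radius of convergence is at least [q]. *)
Lemma CV_radius_gt (c : nat -> R) (t r : R) :
  Rabs t < r -> (forall x, Rabs x < r -> ex_series (fun j => c j * x ^ j)) ->
  Rbar_lt (Rabs t) (CV_radius c).
Proof.
  intros Ht H.
  set (q := (Rabs t + r) / 2).
  assert (Hq : Rabs t < q < r) by (unfold q; lra).
  pose proof (Rabs_pos t) as Hp.
  apply Rbar_lt_le_trans with q; [simpl; lra|].
  destruct (CV_radius_bounded c) as [Hub _]; apply Hub.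
  assert (Hl : is_lim_seq (fun j => c j * q ^ j) 0).
  { apply (ex_series_lim_0 (fun j => c j * q ^ j)), H; rewrite Rabs_pos_eq; lra. }
  destruct (filterlim_bounded (fun j => c j * q ^ j)) as [M HM].
  { exists 0; exact Hl. }
  exists M; exact HM.
Qed.

Lemma is_derive_power_series (c : nat -> R) (f : R -> R) (s0 r : R) :
  0 < r -> (forall s, Rabs (s - s0) < r -> is_series (fun j => c j * (s - s0) ^ j) (f s)) ->
  is_derive f s0 (c 1%nat).
Proof.
  intros Hr H.
  assert (HPS : forall s, Rabs (s - s0) < r -> f s = PSeries c (s - s0)).
  { intros s Hs; symmetry; apply is_series_unique, H, Hs. }
  assert (Hcv : Rbar_lt (Rabs (s0 - s0)) (CV_radius c)).
  { apply CV_radius_gt with r; [rewrite Rminus_diag, Rabs_R0; auto|].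
    intros x Hx; exists (f (x + s0)).
    apply is_series_ext with (fun j => c j * (x + s0 - s0) ^ j).
    { intros j; do 2 f_equal; ring. }
    apply H; replace (x + s0 - s0) with x by ring; auto. }
  apply is_derive_ext_loc with (fun s => PSeries c (s - s0)).
  { exists (mkposreal r Hr); intros s Hs; symmetry; apply HPS; apply Hs. }
  replace (c 1%nat) with (1 * PSeries (PS_derive c) (s0 - s0)).
  2:{ rewrite Rminus_diag, PSeries_0; unfold PS_derive; simpl; ring. }
  apply (is_derive_comp (PSeries c) (fun s => s - s0)).
  - apply is_derive_PSeries; auto.
  - auto_derive; auto; ring.
Qed.

(** The substitute for Cauchy's estimate: the derivative at the centre is c_1, and |c_0| + |c_1| rho
    <= C. *)
Lemma wiener_Derive s0 rho f C :
  0 < rho -> wiener s0 rho f C -> ex_derive f s0 /\ Rabs (Derive f s0) <= C / rho.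
Proof.
  intros Hr [c [H1 H2]].
  assert (Hd : is_derive f s0 (c 1%nat)).
  { apply is_derive_power_series with rho; auto; intros s Hs; apply H2; lra. }
  split; [eexists; apply Hd|].
  rewrite (is_derive_unique _ _ _ Hd).
  specialize (H1 1%nat); simpl in H1; pose proof (Rabs_pos (c O)).
  apply Rmult_le_reg_r with rho; auto; unfold Rdiv; rewrite Rmult_assoc, Rinv_l; lra.
Qed.

(** * Analytic functions on half lines and the identity theorem *)

(** Half lines are the domains used because the continuation of zeta advances to the left by unit
    steps; radius and norm may depend on the point. *)
Definition analytic_above (sigma : R) (f : R -> R) : Prop :=
  forall s0, sigma < s0 -> exists rho C, 0 < rho /\ wiener s0 rho f C.

Lemma analytic_above_ext sigma f g :
  (forall s, sigma < s -> f s = g s) -> analytic_above sigma f -> analytic_above sigma g.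
Proof.
  intros H Hf s0 Hs; destruct (Hf s0 Hs) as [rho [C [Hr Hw]]].
  set (r := Rmin rho ((s0 - sigma) / 2)).
  assert (Hr' : 0 < r <= rho /\ r < s0 - sigma).
  { unfold r; split; [split|].
    - apply Rmin_pos; lra.
    - apply Rmin_l.
    - apply Rle_lt_trans with (1 := Rmin_r _ _); lra. }
  exists r, C; split; [lra|].
  apply wiener_ext with f; [|apply wiener_shrink with rho; auto; lra].
  intros s Hs'; apply H; apply Rabs_le_between in Hs'; lra.
Qed.

Lemma analytic_above_le sigma sigma' f :
  sigma <= sigma' -> analytic_above sigma f -> analytic_above sigma' f.
Proof. intros H Hf s0 Hs; apply Hf; lra. Qed.

Lemma analytic_above_binop (op : R -> R -> R) :
  (forall s0 rho f g C D, 0 < rho -> wiener s0 rho f C -> wiener s0 rho g D ->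
     exists E, wiener s0 rho (fun s => op (f s) (g s)) E) ->
  forall sigma f g, analytic_above sigma f -> analytic_above sigma g ->
  analytic_above sigma (fun s => op (f s) (g s)).
Proof.
  intros H sigma f g Hf Hg s0 Hs.
  destruct (Hf s0 Hs) as [r1 [C [Hr1 H1]]]; destruct (Hg s0 Hs) as [r2 [D [Hr2 H2]]].
  assert (Hm : 0 < Rmin r1 r2) by (apply Rmin_pos; auto).
  destruct (H s0 (Rmin r1 r2) f g C D Hm) as [E HE].
  - apply wiener_shrink with r1; auto; split; [lra|apply Rmin_l].
  - apply wiener_shrink with r2; auto; split; [lra|apply Rmin_r].
  - exists (Rmin r1 r2), E; auto.
Qed.

Lemma analytic_above_plus sigma f g :
  analytic_above sigma f -> analytic_above sigma g ->
  analytic_above sigma (fun s => f s + g s).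
Proof.
  apply (analytic_above_binop Rplus); intros; eexists; apply wiener_plus; eauto; lra.
Qed.

Lemma analytic_above_mult sigma f g :
  analytic_above sigma f -> analytic_above sigma g ->
  analytic_above sigma (fun s => f s * g s).
Proof.
  apply (analytic_above_binop Rmult); intros; eexists; apply wiener_mult; eauto; lra.
Qed.

Lemma analytic_above_lin sigma b d : analytic_above sigma (fun s => b + d * s).
Proof. intros s0 _; exists 1; eexists; split; [lra|apply wiener_lin; lra]. Qed.

Lemma analytic_above_const sigma b : analytic_above sigma (fun _ => b).
Proof.
  apply analytic_above_ext with (fun s => b + 0 * s); [intros; ring|apply analytic_above_lin].
Qed.

Lemma analytic_above_scal sigma b f :
  analytic_above sigma f -> analytic_above sigma (fun s => b * f s).
Proof. intros H; apply analytic_above_mult; auto; apply analytic_above_const. Qed.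

Lemma analytic_above_minus sigma f g :
  analytic_above sigma f -> analytic_above sigma g ->
  analytic_above sigma (fun s => f s - g s).
Proof.
  intros Hf Hg; apply analytic_above_ext with (fun s => f s + -1 * g s); [intros; ring|].
  apply analytic_above_plus; auto; apply analytic_above_scal; auto.
Qed.

Lemma analytic_above_sum sigma (f : nat -> R -> R) n :
  (forall i, (i <= n)%nat -> analytic_above sigma (f i)) ->
  analytic_above sigma (fun s => sum_f_R0 (fun i => f i s) n).
Proof.
  induction n as [|n IH]; intros H; simpl; auto.
  apply analytic_above_plus; auto.
Qed.

Lemma wiener_translate s0 b rho f C :
  wiener (s0 + b) rho f C -> wiener s0 rho (fun s => f (s + b)) C.
Proof.
  intros [c [H1 H2]]; exists c; split; auto.
  intros s Hs.
  apply is_series_ext with (fun j => c j * (s + b - (s0 + b)) ^ j).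
  { intros j; do 2 f_equal; ring. }
  apply H2; replace (s + b - (s0 + b)) with (s - s0) by ring; auto.
Qed.

Lemma analytic_above_translate sigma b f :
  analytic_above (sigma + b) f -> analytic_above sigma (fun s => f (s + b)).
Proof.
  intros H s0 Hs; destruct (H (s0 + b) ltac:(lra)) as [r [C [Hr Hw]]].
  exists r, C; split; auto; apply wiener_translate; auto.
Qed.

Lemma analytic_above_ex_derive sigma f s :
  analytic_above sigma f -> sigma < s -> ex_derive f s.
Proof.
  intros H Hs; destruct (H s Hs) as [r [C [Hr Hw]]]; apply (wiener_Derive s r f C Hr Hw).
Qed.

(** Halving the radius turns plain convergence into absolute convergence up to the boundary, as the
    norm requires. *)
Lemma real_analytic_above sigma f : real_analytic f -> analytic_above sigma f.
Proof.
  intros H s0 _; destruct (H s0) as [r [Hr [c Hc]]].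
  assert (Hs : forall x, Rabs (x - s0) < r -> is_series (fun j => c j * (x - s0) ^ j) (f x)).
  { intros x Hx; apply is_pseries_R, Hc, Hx. }
  assert (Hex : ex_series (fun j => Rabs (c j * (r / 2) ^ j))).
  { apply CV_disk_inside, CV_radius_gt with r; [rewrite Rabs_pos_eq; lra|].
    intros x Hx; exists (f (x + s0)).
    apply is_series_ext with (fun j => c j * (x + s0 - s0) ^ j).
    { intros j; do 2 f_equal; ring. }
    apply Hs; replace (x + s0 - s0) with x by ring; auto. }
  exists (r / 2), (Series (fun j => Rabs (c j * (r / 2) ^ j))); split; [lra|].
  exists c; split.
  - intros n.
    apply Rle_trans with (sum_f_R0 (fun j => Rabs (c j * (r / 2) ^ j)) n).
    + right; apply sum_eq; intros j _.
      rewrite Rabs_mult, (Rabs_pos_eq ((r / 2) ^ j)); auto; apply pow_le; lra.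
    + apply sum_le_Series; auto; intros; apply Rabs_pos.
  - intros s Hs'; apply Hs; lra.
Qed.

Lemma analytic_above_real_analytic f :
  (forall s0, exists rho C, 0 < rho /\ wiener s0 rho f C) -> real_analytic f.
Proof.
  intros H s0; destruct (H s0) as [r [C [Hr [c [_ Hc]]]]].
  exists r; split; auto; exists c; intros x Hx; apply is_pseries_R, Hc; lra.
Qed.

(** Continuity at 0 gives c_0 = 0; dividing by [x] then shifts the coefficients and the argument
    repeats. Vanishing on the right side only is what is known at the supremum taken in
    [analytic_zero]. *)
Lemma power_series_zero_right (r q : R) : 0 < q < r -> forall (n : nat) (c : nat -> R),
  (forall x, Rabs x < r -> ex_series (fun j => c j * x ^ j)) ->
  (forall x, 0 < x < q -> PSeries c x = 0) -> c n = 0.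
Proof.
  intros Hq.
  assert (H0 : forall c : nat -> R,
    (forall x, Rabs x < r -> ex_series (fun j => c j * x ^ j)) ->
    (forall x, 0 < x < q -> PSeries c x = 0) -> c O = 0).
  { intros c Hex Hz.
    assert (Hcv : Rbar_lt (Rabs 0) (CV_radius c)).
    { apply CV_radius_gt with r; auto; rewrite Rabs_R0; lra. }
    destruct (Req_dec (c O) 0) as [|Hne]; auto; exfalso.
    pose proof (PSeries_continuity c 0 Hcv) as Hcont.
    apply continuity_pt_filterlim in Hcont.
    specialize (Hcont _ (locally_ball (PSeries c 0)
      (mkposreal _ (Rabs_pos_lt _ Hne)))).
    destruct Hcont as [d Hd].
    set (x := Rmin (d / 2) (q / 2)).
    assert (Hx : 0 < x /\ x <= d / 2 /\ x <= q / 2).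
    { unfold x; pose proof (cond_pos d); split; [apply Rmin_pos; lra|].
      split; [apply Rmin_l|apply Rmin_r]. }
    specialize (Hd x); rewrite PSeries_0, Hz in Hd by lra.
    assert (Hb : ball 0 d x).
    { change (Rabs (x - 0) < d); rewrite Rminus_0_r, Rabs_pos_eq; pose proof (cond_pos d); lra. }
    specialize (Hd Hb); change (Rabs (0 - c O) < Rabs (c O)) in Hd.
    rewrite Rminus_0_l, Rabs_Ropp in Hd; lra. }
  induction n as [|n IH]; intros c Hex Hz; auto.
  apply (IH (PS_decr_1 c)).
  - intros x Hx.
    destruct (Req_dec x 0) as [->|Hne].
    + eexists; apply (is_series_finite _ 0); intros k Hk; rewrite pow_i; [ring|lia].
    + specialize (Hex x Hx).
      apply (ex_series_incr_1 (fun j => c j * x ^ j)) in Hex.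
      apply (ex_series_scal_r (/ x)) in Hex.
      revert Hex; apply ex_series_ext; intros j; unfold PS_decr_1; simpl; field; auto.
  - intros x Hx.
    assert (E : PSeries c x = c O + x * PSeries (PS_decr_1 c) x).
    { apply PSeries_decr_1, CV_radius_inside, CV_radius_gt with r; auto.
      rewrite Rabs_pos_eq; lra. }
    rewrite Hz, (H0 c) in E; auto.
    apply Rmult_eq_reg_l with x; lra.
Qed.

(** Let [b] be the supremum of the points where [d] does not vanish. Since [d] is zero to the right
    of [b], its power series at [b] is zero, so [d] vanishes on a left neighbourhood of [b] as well,
    against the choice of [b]. *)
Lemma analytic_zero sigma tau d :
  analytic_above sigma d -> (forall s, tau < s -> d s = 0) -> forall s, sigma < s -> d s = 0.
Proof.
  intros Hd Hz s1 Hs1.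
  destruct (Req_dec (d s1) 0) as [|Hne]; auto; exfalso.
  set (E := fun s => sigma < s /\ d s <> 0).
  destruct (completeness E) as [b [Hub Hlub]].
  { exists tau; intros s [_ Hs]; destruct (Rle_dec s tau); auto.
    elim Hs; apply Hz; lra. }
  { exists s1; split; auto. }
  assert (Hb : sigma < b) by (apply Rlt_le_trans with s1; auto; apply Hub; split; auto).
  destruct (Hd b Hb) as [r [C [Hr [c [_ Hc]]]]].
  assert (Hzero : forall s, b < s -> d s = 0).
  { intros s Hs; destruct (Req_dec (d s) 0) as [|Hn]; auto.
    assert (s <= b) by (apply Hub; split; auto; lra); lra. }
  assert (Hc0 : forall n, c n = 0).
  { intros n; apply (power_series_zero_right r (r / 2)); [lra| |].
    - intros x Hx; exists (d (x + b)).
      apply is_series_ext with (fun j => c j * (x + b - b) ^ j).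
      { intros j; do 2 f_equal; ring. }
      apply Hc; replace (x + b - b) with x by ring; lra.
    - intros x Hx; rewrite <- (Hzero (x + b)) by lra.
      apply is_series_unique.
      apply is_series_ext with (fun j => c j * (x + b - b) ^ j).
      { intros j; replace (x + b - b) with x by ring; reflexivity. }
      apply Hc; replace (x + b - b) with x by ring; rewrite Rabs_pos_eq; lra. }
  assert (Hle : b <= b - r); [|lra].
  apply Hlub; intros s [Hs Hn].
  destruct (Rle_dec s (b - r)); auto; elim Hn.
  destruct (Rlt_dec b s); [apply Hzero; auto|].
  rewrite <- (is_series_unique _ _ (Hc s ltac:(rewrite Rabs_left1; lra))).
  apply is_series_unique.
  apply is_series_ext with (fun _ => 0); [intros j; rewrite Hc0; symmetry; apply Rmult_0_l|].
  apply (is_series_finite (fun _ => 0) 0); auto.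
Qed.

Lemma analytic_identity sigma tau f g :
  analytic_above sigma f -> analytic_above sigma g ->
  (forall s, tau < s -> f s = g s) -> forall s, sigma < s -> f s = g s.
Proof.
  intros Hf Hg H s Hs.
  apply Rminus_diag_uniq; revert s Hs.
  apply (analytic_zero sigma tau (fun s => f s - g s)); [apply analytic_above_minus; auto|].
  intros s Hs; rewrite H; auto; ring.
Qed.

(** * The binomial series and Taylor remainders of x^(-s) *)

(** The generalised binomial coefficient, built as a product of linear factors in [z] so that its
    norm can be bounded factor by factor. *)
Fixpoint bin (z : R) (j : nat) : R :=
  match j with O => 1 | S i => bin z i * ((z - INR i) / INR (S i)) end.

(* [bin_majorant A j] is the absolute value of [bin (- A) j]. *)
Fixpoint bin_majorant (A : R) (j : nat) : R :=
  match j with O => 1 | S i => bin_majorant A i * ((A + INR i) / INR (S i)) end.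

Lemma bin_majorant_pos A j : 0 < A -> 0 < bin_majorant A j.
Proof.
  intros HA; induction j as [|j IH]; [simpl; lra|].
  cbn [bin_majorant]; pose proof (pos_INR j); pose proof (lt_0_INR (S j) ltac:(lia)).
  apply Rmult_lt_0_compat; auto; apply Rdiv_lt_0_compat; lra.
Qed.

Lemma bin_abs_le z A j : Rabs z <= A -> Rabs (bin z j) <= bin_majorant A j.
Proof.
  intros HA; induction j as [|j IH]; [simpl; rewrite Rabs_R1; lra|].
  cbn [bin_majorant bin]; pose proof (pos_INR j); pose proof (lt_0_INR (S j) ltac:(lia)).
  rewrite Rabs_mult; apply Rmult_le_compat; auto; try apply Rabs_pos.
  unfold Rdiv; rewrite Rabs_mult, (Rabs_pos_eq (/ INR (S j))).
  2:{ left; apply Rinv_0_lt_compat; auto. }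
  apply Rmult_le_compat_r; [left; apply Rinv_0_lt_compat; auto|].
  apply Rle_trans with (1 := Rabs_triang _ _).
  rewrite Rabs_Ropp, (Rabs_pos_eq (INR j)); lra.
Qed.

Lemma bin_majorant_ex_series A tau :
  0 < A -> 0 < tau < 1 -> ex_series (fun j => bin_majorant A j * tau ^ j).
Proof.
  intros HA Ht.
  assert (Hp : forall j, 0 < bin_majorant A j * tau ^ j).
  { intros j; apply Rmult_lt_0_compat; [apply bin_majorant_pos; auto|apply pow_lt; lra]. }
  apply ex_series_Rabs, ex_series_DAlembert with tau; [lra|intros n; specialize (Hp n); lra|].
  apply is_lim_seq_ext with (fun n => tau + (A - 1) * tau * / INR (S n)).
  { intros n; rewrite Rabs_pos_eq.
    2:{ left; apply Rdiv_lt_0_compat; auto. }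
    pose proof (lt_0_INR (S n) ltac:(lia)).
    pose proof (bin_majorant_pos A n HA); pose proof (pow_lt tau n ltac:(lra)).
    cbn [bin_majorant pow]; rewrite S_INR in *; field; repeat split; lra. }
  replace (Finite tau) with (Finite (tau + (A - 1) * tau * 0)) by (f_equal; ring).
  apply is_lim_seq_plus'; [apply is_lim_seq_const|].
  apply is_lim_seq_mult'; [apply is_lim_seq_const|].
  apply (is_lim_seq_incr_1 (fun n => / INR n)).
  replace (Finite 0) with (Rbar_inv p_infty) by reflexivity.
  apply is_lim_seq_inv; [apply is_lim_seq_INR|discriminate].
Qed.

Lemma bin_ex_series z x : Rabs x < 1 -> ex_series (fun j => bin z j * x ^ j).
Proof.
  intros Hx; pose proof (Rabs_pos x); pose proof (Rabs_pos z).
  apply ex_series_le_R with (fun j => bin_majorant (Rabs z + 1) j * ((Rabs x + 1) / 2) ^ j).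
  - intros j; rewrite Rabs_mult; apply Rmult_le_compat; try apply Rabs_pos.
    + apply bin_abs_le; lra.
    + rewrite <- RPow_abs; apply pow_incr; split; lra.
  - apply bin_majorant_ex_series; lra.
Qed.

(** The sum [f] satisfies (1 + t) f' = z f, so f(t) (1 + t)^(-z) has derivative zero on (-1, 1) and
    keeps its value 1 at t = 0. *)
Lemma binomial_series z u : Rabs u < 1 -> is_series (fun j => bin z j * u ^ j) (Rpower (1 + u) z).
Proof.
  intros Hu.
  assert (Hcv : forall t, Rabs t < 1 -> Rbar_lt (Rabs t) (CV_radius (bin z))).
  { intros t Ht; apply CV_radius_gt with 1; auto; intros x Hx; apply bin_ex_series; auto. }
  set (f := PSeries (bin z)).
  assert (Hode : forall t, Rabs t < 1 ->
    (1 + t) * PSeries (PS_derive (bin z)) t = z * f t).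
  { intros t Ht.
    assert (Hex : ex_pseries (PS_derive (bin z)) t).
    { apply CV_radius_inside; rewrite CV_radius_derive; auto. }
    replace ((1 + t) * PSeries (PS_derive (bin z)) t) with
      (PSeries (PS_derive (bin z)) t + PSeries (PS_incr_1 (PS_derive (bin z))) t).
    2:{ rewrite PSeries_incr_1; ring. }
    rewrite <- PSeries_plus; auto; [|apply ex_pseries_incr_1; auto].
    unfold f; rewrite <- PSeries_scal; apply PSeries_ext; intros n.
    unfold PS_plus, PS_scal, PS_incr_1, PS_derive, plus, scal; simpl; unfold mult; simpl.
    destruct n as [|n].
    - simpl; unfold zero; simpl; field.
    - cbn [bin]; rewrite !S_INR; pose proof (pos_INR n).
      assert (INR n + 1 <> 0) by lra; assert (INR n + 1 + 1 <> 0) by lra.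
      field; repeat split; auto; destruct n; auto; lra. }
  set (h := fun t => f t * Rpower (1 + t) (- z)).
  assert (Hh : forall t, Rabs t < 1 -> is_derive h t 0).
  { intros t Ht; pose proof (Rabs_def2 _ _ Ht).
    assert (Hp : is_derive (fun t => Rpower (1 + t) (- z)) t
      (- z / (1 + t) * Rpower (1 + t) (- z))).
    { unfold Rpower; auto_derive; [lra|field; lra]. }
    replace 0 with (PSeries (PS_derive (bin z)) t * Rpower (1 + t) (- z) +
      f t * (- z / (1 + t) * Rpower (1 + t) (- z))).
    - apply (is_derive_mult (K := R_AbsRing) f (fun t => Rpower (1 + t) (- z))); auto.
      + apply is_derive_PSeries; auto.
      + intros; apply Rmult_comm.
    - replace (PSeries (PS_derive (bin z)) t) with (z * f t / (1 + t)); [field; lra|].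
      rewrite <- Hode; auto; field; lra. }
  assert (Hc : h u = h 0).
  { destruct (MVT_gen h 0 u (fun _ => 0)) as [c [_ E]].
    - intros t Ht; apply Hh; unfold Rmin, Rmax in Ht; apply Rabs_def2 in Hu;
      destruct (Rle_dec 0 u); apply Rabs_def1; lra.
    - intros t Ht; apply continuity_pt_filterlim, (ex_derive_continuous h).
      exists 0; apply Hh; unfold Rmin, Rmax in Ht; apply Rabs_def2 in Hu;
      destruct (Rle_dec 0 u); apply Rabs_def1; lra.
    - lra. }
  unfold h in Hc.
  assert (Hf : f u = Rpower (1 + u) z).
  { unfold f in Hc at 2; rewrite PSeries_0 in Hc; cbn [bin] in Hc.
    rewrite Rplus_0_r in Hc; unfold Rpower in Hc at 2; rewrite ln_1, Rmult_0_r, exp_0 in Hc.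
    rewrite Rpower_Ropp in Hc.
    pose proof (exp_pos (z * ln (1 + u))) as Hp; fold (Rpower (1 + u) z) in Hp.
    apply Rmult_eq_reg_r with (/ Rpower (1 + u) z).
    - rewrite Hc; field; lra.
    - apply Rinv_neq_0_compat; lra. }
  rewrite <- Hf; apply Series_correct, bin_ex_series; auto.
Qed.

(** The series is that of x^(-s0) exp(- (s - s0) ln x); taking absolute values of the coefficients
    replaces the second factor by exp(rho |ln x|). *)
Lemma wiener_Rpower x s0 rho : 0 <= rho ->
  wiener s0 rho (fun s => Rpower x (- s)) (exp (- s0 * ln x + rho * Rabs (ln x))).
Proof.
  intros Hr; set (L := ln x).
  assert (Hexp : forall t, is_series (fun j => / INR (fact j) * t ^ j) (exp t)).
  { intros t; apply is_pseries_R, is_exp_Reals. }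
  exists (fun j => exp (- s0 * L) * ((- L) ^ j * / INR (fact j))); split.
  - intros n; rewrite exp_plus.
    rewrite <- (is_series_unique _ _ (Hexp (rho * Rabs L))).
    apply Rle_trans with (exp (- s0 * L) *
      sum_f_R0 (fun j => / INR (fact j) * (rho * Rabs L) ^ j) n).
    + rewrite scal_sum; right; apply sum_eq; intros j _.
      pose proof (INR_fact_lt_0 j).
      rewrite !Rabs_mult, (Rabs_pos_eq (exp _)) by (left; apply exp_pos).
      rewrite <- RPow_abs, Rabs_Ropp, (Rabs_pos_eq (/ _)).
      2:{ left; apply Rinv_0_lt_compat; auto. }
      rewrite Rpow_mult_distr; ring.
    + apply Rmult_le_compat_l; [left; apply exp_pos|].
      apply sum_le_Series; [|eexists; apply Hexp].
      intros j; apply Rmult_le_pos.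
      * left; apply Rinv_0_lt_compat, INR_fact_lt_0.
      * apply pow_le, Rmult_le_pos; auto; apply Rabs_pos.
  - intros s _.
    unfold Rpower; fold L.
    replace (- s * L) with (- s0 * L + (s - s0) * - L) by ring; rewrite exp_plus.
    apply is_series_ext with
      (fun j => scal (exp (- s0 * L)) (/ INR (fact j) * ((s - s0) * - L) ^ j)).
    { intros j; unfold scal; simpl; unfold mult; simpl; rewrite Rpow_mult_distr; ring. }
    apply (is_series_scal (V := R_NormedModule)); auto.
Qed.

(** Each factor (- s - i) / (i + 1) has norm at most (|s0| + rho + i) / (i + 1), the corresponding
    factor of [bin_majorant]. *)
Lemma wiener_bin s0 rho j : 0 <= rho ->
  wiener s0 rho (fun s => bin (- s) j) (bin_majorant (Rabs s0 + rho) j).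
Proof.
  intros Hr; induction j as [|j IH].
  - apply wiener_le with (Rabs (1 + 0 * s0) + Rabs 0 * rho).
    + simpl; rewrite Rmult_0_l, Rplus_0_r, Rabs_R0, Rabs_R1; lra.
    + apply wiener_ext_all with (fun s => 1 + 0 * s); [intros; simpl; ring|].
      apply wiener_lin; auto.
  - pose proof (lt_0_INR (S j) ltac:(lia)) as Hj; pose proof (pos_INR j) as Hj'.
    cbn [bin bin_majorant]; apply wiener_mult; auto.
    apply wiener_ext_all with (fun s => - INR j / INR (S j) + - / INR (S j) * s).
    { intros s; field; lra. }
    eapply wiener_le; [|apply wiener_lin; auto].
    replace (- INR j / INR (S j) + - / INR (S j) * s0) with (- ((INR j + s0) / INR (S j)))
      by (field; lra).
    rewrite !Rabs_Ropp; unfold Rdiv; rewrite Rabs_mult.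
    rewrite (Rabs_pos_eq (/ INR (S j))) by (left; apply Rinv_0_lt_compat; auto).
    rewrite (Rmult_comm (/ _)), <- Rmult_plus_distr_r.
    apply Rmult_le_compat_r; [left; apply Rinv_0_lt_compat; auto|].
    pose proof (Rabs_triang (INR j) s0); rewrite (Rabs_pos_eq (INR j)) in *; lra.
Qed.

(** The exponents are written s + j so that summation over x = n + a turns the j-th term into a
    multiple of zeta(s + j, a). *)
Definition taylor_rem (K : nat) (x y s : R) : R :=
  Rpower (x + y) (- s) -
  sum_f_R0 (fun j => bin (- s) j * Rpower x (- (s + INR j)) * y ^ j) K.

Lemma Rpower_minus_INR x s j : 0 < x ->
  Rpower x (- (s + INR j)) = Rpower x (- s) * (/ x) ^ j.
Proof.
  intros Hx; rewrite Ropp_plus_distr, Rpower_plus, Rpower_Ropp with (y := INR j).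
  rewrite Rpower_pow, pow_inv; auto.
Qed.

Lemma taylor_rem_series K x y s : 0 < x -> Rabs y < x ->
  taylor_rem K x y s =
  Rpower x (- s) * Series (fun j => bin (- s) (S K + j) * (y / x) ^ (S K + j)).
Proof.
  intros Hx Hy.
  assert (Hu : Rabs (y / x) < 1).
  { unfold Rdiv; rewrite Rabs_mult, (Rabs_pos_eq (/ x)).
    - apply Rmult_lt_reg_r with x; auto; rewrite Rmult_assoc, Rinv_l; lra.
    - left; apply Rinv_0_lt_compat; auto. }
  pose proof (binomial_series (- s) (y / x) Hu) as Hb.
  pose proof (Series_incr_n _ (S K) ltac:(lia) (ex_intro _ _ Hb)) as E.
  rewrite (is_series_unique _ _ Hb) in E; simpl pred in E.
  unfold taylor_rem.
  replace (x + y) with (x * (1 + y / x)) by (field; lra).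
  pose proof (Rabs_def2 _ _ Hu).
  rewrite <- Rpower_mult_distr by lra.
  rewrite E, Rmult_plus_distr_l, (scal_sum _ K (Rpower x (- s))).
  match goal with |- ?p + ?q - ?r = _ => enough (Hpr : p = r) by lra end.
  apply sum_eq; intros j _.
  rewrite Rpower_minus_INR by auto; unfold Rdiv; rewrite Rpow_mult_distr; ring.
Qed.

(** The factor (|y| / x)^(K + 1) is pulled out of the tail of the binomial series, leaving a sum
    bounded through [tau]. It supplies both the power of [y] needed to differentiate in [a] and the
    decay in [x] needed to sum over x = n + a. *)
Lemma wiener_taylor_rem K x y s0 rho tau :
  0 < x -> 0 < tau < 1 -> Rabs y <= tau * x -> 0 < rho ->
  wiener s0 rho (taylor_rem K x y)
    (exp (- s0 * ln x + rho * Rabs (ln x)) *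
      ((Rabs y / x) ^ (S K) *
       Series (fun j => bin_majorant (Rabs s0 + rho) (S K + j) * tau ^ j))).
Proof.
  intros Hx Ht Hy Hr.
  assert (Hlt : Rabs y < x).
  { apply Rle_lt_trans with (1 := Hy); rewrite <- (Rmult_1_l x) at 2.
    apply Rmult_lt_compat_r; lra. }
  apply wiener_ext_all with (fun s => Rpower x (- s) *
    Series (fun j => bin (- s) (S K + j) * (y / x) ^ (S K + j))).
  { intros s; symmetry; apply taylor_rem_series; auto. }
  apply wiener_mult; [apply wiener_Rpower; lra| |lra].
  rewrite Rmult_comm, <- Series_scal_r.
  pose proof (Rabs_pos s0).
  assert (Hyx : 0 <= Rabs y / x <= tau).
  { split.
    - apply Rmult_le_pos; [apply Rabs_pos|left; apply Rinv_0_lt_compat; auto].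
    - apply Rmult_le_reg_r with x; auto; unfold Rdiv; rewrite Rmult_assoc, Rinv_l; lra. }
  apply (wiener_series s0 rho (fun j s => bin (- s) (S K + j) * (y / x) ^ (S K + j))); [lra| |].
  - intros j.
    set (p := (y / x) ^ (S K + j)).
    apply wiener_ext_all with (fun s => bin (- s) (S K + j) * (p + 0 * s)); [intros; ring|].
    rewrite Rmult_assoc.
    apply wiener_mult; [apply wiener_bin; lra| |lra].
    eapply wiener_le; [|apply wiener_lin; lra].
    rewrite Rmult_0_l, Rplus_0_r, Rabs_R0, Rmult_0_l, Rplus_0_r.
    unfold p; rewrite <- RPow_abs; unfold Rdiv at 1; rewrite Rabs_mult.
    rewrite (Rabs_pos_eq (/ x)) by (left; apply Rinv_0_lt_compat; auto).
    rewrite Nat.add_comm, pow_add; fold (Rabs y / x).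
    apply Rmult_le_compat_r; [apply pow_le; lra|apply pow_incr; lra].
  - apply (ex_series_scal_r ((Rabs y / x) ^ S K)
      (fun j => bin_majorant (Rabs s0 + rho) (S K + j) * tau ^ j)).
    pose proof (bin_majorant_ex_series (Rabs s0 + rho) tau ltac:(lra) Ht) as He.
    apply (ex_series_incr_n _ (S K)) in He.
    apply (ex_series_scal_r (/ tau ^ S K)) in He.
    revert He; apply ex_series_ext; intros j; rewrite pow_add.
    change (bin_majorant (Rabs s0 + rho) (S K + j) * (tau ^ S K * tau ^ j) * / tau ^ S K =
      bin_majorant (Rabs s0 + rho) (S K + j) * tau ^ j).
    field; apply pow_nonzero; lra.
Qed.

(** * The Hurwitz series and the summed Taylor remainders *)

Lemma Rpower_pos x y : 0 < Rpower x y.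
Proof. apply exp_pos. Qed.

(** Comparison with the integral of t^(-p), done by the mean value theorem: each term is at most a
    difference of values of t^(1 - p) / (p - 1), and these differences telescope. *)
Lemma pseries_ex a p : 0 < a -> 1 < p -> ex_series (fun n => Rpower (INR n + a) (- p)).
Proof.
  intros Ha Hp.
  apply (ex_series_incr_1 (fun n => Rpower (INR n + a) (- p))).
  assert (Hstep : forall x, 0 < x ->
    Rpower (x + 1) (- p) <= / (p - 1) * (Rpower x (1 - p) - Rpower (x + 1) (1 - p))).
  { intros x Hx.
    destruct (MVT_gen (fun t => Rpower t (1 - p)) x (x + 1)
      (fun t => (1 - p) * Rpower t (- p))) as [c [Hc E]].
    - intros t Ht; rewrite Rmin_left in Ht by lra.
      replace (- p) with (1 - p + - (1)) by ring.
      rewrite Rpower_plus; replace (Rpower t (- (1))) with (/ t).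
      2:{ rewrite Rpower_Ropp, Rpower_1; lra. }
      unfold Rpower; auto_derive; [lra|field; lra].
    - intros t Ht; rewrite Rmin_left in Ht by lra.
      apply continuity_pt_filterlim, (ex_derive_continuous (fun t => Rpower t (1 - p))).
      unfold Rpower; auto_derive; lra.
    - rewrite Rmin_left, Rmax_right in Hc by lra.
      replace (Rpower x (1 - p) - Rpower (x + 1) (1 - p)) with ((p - 1) * Rpower c (- p)) by lra.
      rewrite <- Rmult_assoc, Rinv_l, Rmult_1_l by lra.
      rewrite !Rpower_Ropp; apply Rinv_le_contravar; [apply Rpower_pos|].
      apply Rle_Rpower_l; lra. }
  apply ex_series_bounded_pos with (/ (p - 1) * Rpower a (1 - p)).
  { intros n; left; apply Rpower_pos. }
  assert (H : forall n, sum_f_R0 (fun k => Rpower (INR (S k) + a) (- p)) n <=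
    / (p - 1) * (Rpower a (1 - p) - Rpower (INR (S n) + a) (1 - p))).
  { induction n as [|n IH].
    - simpl; specialize (Hstep a Ha); rewrite (Rplus_comm 1 a); lra.
    - cbn [sum_f_R0]; pose proof (pos_INR (S n)).
      specialize (Hstep (INR (S n) + a) ltac:(lra)).
      rewrite (S_INR (S n)); replace (INR (S n) + 1 + a) with (INR (S n) + a + 1) by ring; lra. }
  intros n; apply Rle_trans with (1 := H n).
  apply Rmult_le_compat_l; [left; apply Rinv_0_lt_compat; lra|].
  pose proof (Rpower_pos (INR (S n) + a) (1 - p)); lra.
Qed.

Definition zser (a s : R) : R := Series (fun n => Rpower (INR n + a) (- s)).

(** The summands decay like n^(- s - K - 1), so the sum makes sense already for s > - K; this gain
    is the source of the continuation. *)
Definition zeta_rem (K : nat) (a y s : R) : R :=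
  Series (fun n => taylor_rem K (INR n + a) y s).

(* At [x >= a] the radius [rho] costs the factor [x ^ rho], up to a constant
   which accounts for [x < 1]. *)
Lemma exp_radius_le a x s0 rho : 0 < a <= x -> 0 <= rho ->
  exp (- s0 * ln x + rho * Rabs (ln x)) <=
  exp (2 * rho * Rabs (ln a)) * Rpower x (- (s0 - rho)).
Proof.
  intros Hx Hr; unfold Rpower; rewrite <- exp_plus.
  assert (Hln : ln a <= ln x).
  { destruct (Req_dec a x) as [->|]; [lra|left; apply ln_increasing; lra]. }
  assert (H : Rabs (ln x) <= ln x + 2 * Rabs (ln a)).
  { unfold Rabs; destruct (Rcase_abs (ln x)), (Rcase_abs (ln a)); lra. }
  apply (Rmult_le_compat_l rho) in H; auto.
  match goal with |- exp ?p <= exp ?q => destruct (Req_dec p q) as [->|Hn]; [lra|] end.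
  left; apply exp_increasing; lra.
Qed.

Lemma wiener_zser a s0 rho : 0 < a -> 0 < rho -> 1 < s0 - rho ->
  exists C, wiener s0 rho (zser a) C.
Proof.
  intros Ha Hr Hs.
  exists (Series (fun n => Rpower (INR n + a) (- (s0 - rho)) * exp (2 * rho * Rabs (ln a)))).
  apply (wiener_series s0 rho (fun n s => Rpower (INR n + a) (- s))); [lra| |].
  - intros n; pose proof (pos_INR n).
    eapply wiener_le; [|apply wiener_Rpower; lra].
    rewrite (Rmult_comm (Rpower _ _)); apply exp_radius_le; lra.
  - apply (ex_series_scal_r (exp (2 * rho * Rabs (ln a)))
      (fun n => Rpower (INR n + a) (- (s0 - rho)))); apply pseries_ex; auto.
Qed.

(** What matters is that [C] does not depend on [y]: the whole function of [s] is of order |y|^(K +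
    1) in norm. *)
Lemma wiener_zeta_rem K a tau s0 rho :
  0 < a -> 0 < tau < 1 -> 0 < rho -> - INR K < s0 - rho ->
  exists C, forall y, Rabs y <= tau * a ->
    wiener s0 rho (zeta_rem K a y) (Rabs y ^ (S K) * C).
Proof.
  intros Ha Ht Hr Hs.
  set (B := Series (fun j => bin_majorant (Rabs s0 + rho) (S K + j) * tau ^ j)).
  set (D := exp (2 * rho * Rabs (ln a))).
  exists (Series (fun n => Rpower (INR n + a) (- (s0 - rho + INR (S K))) * (D * B))).
  intros y Hy.
  rewrite Rmult_comm, <- Series_scal_r.
  (* The sign of [B] is read off from the norm bound for one remainder, at x = 1 and y = tau, where
     the other factors are positive. *)
  assert (HB : 0 <= B).
  { pose proof (wiener_pos _ _ _ _ (wiener_taylor_rem K 1 tau s0 rho tau ltac:(lra) Ht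
      ltac:(rewrite Rabs_pos_eq; lra) Hr)) as Hp.
    rewrite (Rabs_pos_eq tau) in Hp by lra; fold B in Hp.
    pose proof (exp_pos (- s0 * ln 1 + rho * Rabs (ln 1))) as H1.
    assert (H2 : 0 < (tau / 1) ^ S K) by (apply pow_lt; lra).
    rewrite <- Rmult_assoc in Hp.
    pose proof (Rmult_lt_0_compat _ _ H1 H2).
    apply Rmult_le_reg_l with (2 := eq_ind_r (fun z => z <= _) Hp (Rmult_0_r _)); auto. }
  apply (wiener_series s0 rho (fun n => taylor_rem K (INR n + a) y)); [lra| |].
  - intros n; pose proof (pos_INR n) as Hn.
    eapply wiener_le; [|apply wiener_taylor_rem with (tau := tau); auto; try lra].
    2:{ apply Rle_trans with (1 := Hy); apply Rmult_le_compat_l; lra. }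
    fold B; set (x := INR n + a).
    rewrite Rpower_minus_INR by (unfold x; lra).
    unfold Rdiv; rewrite Rpow_mult_distr.
    pose proof (exp_radius_le a x s0 rho ltac:(unfold x; lra) ltac:(lra)) as He; fold D in He.
    assert (Hp : 0 <= Rabs y ^ S K * (/ x) ^ S K * B).
    { apply Rmult_le_pos; auto; apply Rmult_le_pos; apply pow_le; [apply Rabs_pos|].
      left; apply Rinv_0_lt_compat; unfold x; lra. }
    apply Rle_trans with (D * Rpower x (- (s0 - rho)) * (Rabs y ^ S K * (/ x) ^ S K * B)).
    + apply Rmult_le_compat_r; auto.
    + right; ring.
  - apply (ex_series_scal_r (Rabs y ^ S K)
      (fun n => Rpower (INR n + a) (- (s0 - rho + INR (S K))) * (D * B))).
    apply (ex_series_scal_r (D * B) (fun n => Rpower (INR n + a) (- (s0 - rho + INR (S K))))).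
    apply pseries_ex; auto; rewrite S_INR; lra.
Qed.

Lemma zeta_rem_eq K a y s : 0 < a -> Rabs y < a -> 1 < s ->
  zeta_rem K a y s =
  zser (a + y) s - sum_f_R0 (fun j => bin (- s) j * zser a (s + INR j) * y ^ j) K.
Proof.
  intros Ha Hy Hs; unfold zeta_rem, taylor_rem.
  pose proof (Rabs_def2 _ _ Hy).
  assert (Hex : forall j,
    ex_series (fun n => bin (- s) j * Rpower (INR n + a) (- (s + INR j)) * y ^ j)).
  { intros j; apply (ex_series_scal_r (y ^ j)
      (fun n => bin (- s) j * Rpower (INR n + a) (- (s + INR j)))).
    apply (ex_series_scal_l (bin (- s) j) (fun n => Rpower (INR n + a) (- (s + INR j)))).
    apply pseries_ex; auto; pose proof (pos_INR j); lra. }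
  destruct (Series_sum_swap
    (fun n j => bin (- s) j * Rpower (INR n + a) (- (s + INR j)) * y ^ j) K Hex) as [H1 H2].
  rewrite Series_minus; auto.
  - rewrite H2; f_equal.
    + apply Series_ext; intros n; rewrite Rplus_assoc; reflexivity.
    + apply sum_eq; intros j _; rewrite Series_scal_r, Series_scal_l; reflexivity.
  - apply ex_series_ext with (fun n => Rpower (INR n + (a + y)) (- s)).
    { intros n; rewrite Rplus_assoc; reflexivity. }
    apply pseries_ex; lra.
Qed.

Lemma analytic_zser a : 0 < a -> analytic_above 1 (zser a).
Proof.
  intros Ha s0 Hs; destruct (wiener_zser a s0 ((s0 - 1) / 2)) as [C HC]; try lra.
  exists ((s0 - 1) / 2), C; split; [lra|auto].
Qed.

Lemma analytic_zeta_rem K a y :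
  0 < a -> Rabs y < a -> analytic_above (- INR K) (zeta_rem K a y).
Proof.
  intros Ha Hy s0 Hs; pose proof (Rabs_pos y).
  set (tau := (Rabs y / a + 1) / 2).
  assert (Hq : 0 <= Rabs y / a < 1).
  { split; [apply Rmult_le_pos; auto; left; apply Rinv_0_lt_compat; auto|].
    apply Rmult_lt_reg_r with a; auto; unfold Rdiv; rewrite Rmult_assoc, Rinv_l; lra. }
  destruct (wiener_zeta_rem K a tau s0 ((s0 + INR K) / 2)) as [C HC]; auto; try lra.
  { unfold tau; lra. }
  exists ((s0 + INR K) / 2), (Rabs y ^ S K * C); split; [lra|]; apply HC.
  replace (Rabs y) with (Rabs y / a * a) at 1 by (field; lra).
  apply Rmult_le_compat_r; unfold tau; lra.
Qed.

Lemma analytic_bin sigma j : analytic_above sigma (fun s => bin (- s) j).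
Proof. intros s0 _; exists 1; eexists; split; [lra|apply wiener_bin; lra]. Qed.

Lemma analytic_Rpower sigma a : analytic_above sigma (fun s => Rpower a (- s)).
Proof. intros s0 _; exists 1; eexists; split; [lra|apply wiener_Rpower; lra]. Qed.

(** * Analytic continuation in s *)

Lemma zser_shift a s : 0 < a -> 1 < s -> zser a s = Rpower a (- s) + zser (a + 1) s.
Proof.
  intros Ha Hs; unfold zser; rewrite Series_incr_1 by (apply pseries_ex; auto).
  f_equal; [simpl INR; rewrite Rplus_0_l; auto|].
  apply Series_ext; intros n; rewrite S_INR; f_equal; ring.
Qed.

Lemma sum_eq_opp (f g : nat -> R) n :
  (forall i, f i = - g i) -> sum_f_R0 f n = - sum_f_R0 g n.
Proof. intros H; induction n as [|n IH]; simpl; rewrite H; [|rewrite IH]; lra. Qed.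

(** The last factor of [bin (- s) (S i)] is - (s + i) / (i + 1), and s + i is exactly the factor
    that cancels the pole of zeta(s + i + 1, a). Hence the terms of positive order involve only
    regularised zeta functions. *)
Lemma zeta_rem_expand I a y s : 0 < a -> Rabs y < a -> 1 < s ->
  zeta_rem (S I) a y s = zser (a + y) s - zser a s +
  sum_f_R0 (fun i => bin (- s) i / INR (S i) *
    ((s + INR (S i) - 1) * zser a (s + INR (S i))) * y ^ S i) I.
Proof.
  intros Ha Hy Hs; rewrite zeta_rem_eq by auto.
  rewrite decomp_sum by lia; simpl pred.
  replace (bin (- s) 0 * zser a (s + INR 0) * y ^ 0) with (zser a s)
    by (simpl; rewrite Rplus_0_r; ring).
  match goal with |- ?p - (?q + ?u) = _ - _ + ?v => enough (u = - v) by lra end.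
  apply sum_eq_opp; intros i.
  cbn [bin]; rewrite S_INR; pose proof (pos_INR i); field; lra.
Qed.

(* Summing the Taylor expansion of [x^(1-s)] with increment 1 over [x = n + a]
   telescopes on the left and so expresses [(s - 1) zeta(s, a)] through its
   values at [s + 1], [s + 2], ... and a remainder analytic further to the left. *)
Lemma hurwitz_step a (F : R -> R) (M : nat) : 1 < a ->
  analytic_above (1 - INR M) F -> (forall s, 1 < s -> F s = (s - 1) * zser a s) ->
  exists G, analytic_above (1 - INR (S M)) G /\ forall s, 1 < s -> G s = (s - 1) * zser a s.
Proof.
  intros Ha HF HFz.
  (* The expansion at s - 1 solved for its term of order 1, which is (s - 1) zeta(s, a). The other
     terms evaluate [F] at s + 1 or further right, hence are analytic one unit further left;
     increment 1 is the reason for assuming 1 < a. *)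
  set (G := fun s => zeta_rem (S (S M)) a 1 (s + -1) + Rpower a (- (s + -1)) -
    sum_f_R0 (fun l => / INR (S (S l)) * (bin (- (s + -1)) (S l) * F (s + INR (S l)))) M).
  assert (HG : analytic_above (1 - INR (S M)) G).
  { unfold G; apply analytic_above_minus; [apply analytic_above_plus|apply analytic_above_sum].
    - apply (analytic_above_translate _ (-1) (zeta_rem (S (S M)) a 1)).
      apply analytic_above_le with (- INR (S (S M))); [rewrite !S_INR; lra|].
      apply analytic_zeta_rem; [lra|rewrite Rabs_R1; auto].
    - apply (analytic_above_translate _ (-1) (fun s => Rpower a (- s))), analytic_Rpower.
    - intros l _; apply analytic_above_scal, analytic_above_mult.
      + apply (analytic_above_translate _ (-1) (fun s => bin (- s) (S l))), analytic_bin.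
      + apply analytic_above_translate, analytic_above_le with (2 := HF).
        rewrite !S_INR; pose proof (pos_INR l); lra. }
  exists G; split; auto.
  intros s Hs; rewrite <- HFz by auto.
  pose proof (pos_INR M).
  (* The series at s - 1 converges only for s > 2; the identity theorem brings the equality down to
     s > 1. *)
  apply (analytic_identity (1 - INR M) 2 G F); auto; [| |lra].
  - apply analytic_above_le with (2 := HG); rewrite S_INR; lra.
  - clear s Hs; intros s Hs; unfold G.
    rewrite zeta_rem_expand; [|lra|rewrite Rabs_R1; auto|lra].
    rewrite decomp_sum by lia; simpl pred.
    rewrite (zser_shift a (s + -1)) by lra.
    rewrite HFz by lra.
    replace (bin (- (s + -1)) 0 / INR 1 *
      ((s + -1 + INR 1 - 1) * zser a (s + -1 + INR 1)) * 1 ^ 1) with ((s - 1) * zser a s).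
    2:{ simpl; replace (s + -1 + 1) with s by ring; field. }
    match goal with |- ?p - (?q + ?p) + (?r + ?u) + ?q - ?v = _ => enough (u = v) by lra end.
    apply sum_eq; intros l _; rewrite HFz, pow1.
    2:{ pose proof (lt_0_INR (S l) ltac:(lia)); lra. }
    assert (HSl : INR (S (S l)) = INR (S l) + 1) by apply S_INR.
    replace (s + -1 + INR (S (S l))) with (s + INR (S l)) by lra.
    unfold Rdiv; ring.
Qed.

Definition analytic_all (f : R -> R) : Prop := forall sigma, analytic_above sigma f.

Lemma analytic_all_identity tau f g :
  analytic_all f -> analytic_all g -> (forall s, tau < s -> f s = g s) -> forall s, f s = g s.
Proof.
  intros Hf Hg H s; apply (analytic_identity (s - 1) tau f g); auto; lra.
Qed.

Lemma analytic_all_ex_derive f s : analytic_all f -> ex_derive f s.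
Proof. intros H; apply (analytic_above_ex_derive (s - 1)); auto; lra. Qed.

Lemma analytic_all_wiener f s0 : analytic_all f -> exists rho C, 0 < rho /\ wiener s0 rho f C.
Proof. intros H; apply (H (s0 - 1)); lra. Qed.

Lemma analytic_all_real_analytic f : analytic_all f -> real_analytic f.
Proof. intros H; apply analytic_above_real_analytic; intros s0; apply analytic_all_wiener, H. Qed.

Definition is_reg_zeta (a : R) (F : R -> R) : Prop :=
  analytic_all F /\ forall s, 1 < s -> F s = (s - 1) * zser a s.

(** The continuations to s > 1 - M are glued: at each [s] some admissible [M] is chosen, and any two
    continuations agree on their common half line. *)
Lemma reg_zeta_ex_gt1 a : 1 < a -> exists F, is_reg_zeta a F.
Proof.
  intros Ha.
  assert (H : forall M, exists F, analytic_above (1 - INR M) F /\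
    forall s, 1 < s -> F s = (s - 1) * zser a s).
  { induction M as [|M [F [H1 H2]]].
    - exists (fun s => (-1 + 1 * s) * zser a s); split; [|intros; ring].
      simpl INR; rewrite Rminus_0_r; apply analytic_above_mult; [apply analytic_above_lin|].
      apply analytic_zser; lra.
    - apply hurwitz_step with F; auto. }
  set (F := fun M => proj1_sig (constructive_indefinite_description _ (H M))).
  assert (HF : forall M, analytic_above (1 - INR M) (F M) /\
    forall s, 1 < s -> F M s = (s - 1) * zser a s).
  { intros M; unfold F; destruct (constructive_indefinite_description _ _); auto. }
  clearbody F.
  assert (HN : forall s, exists M, 1 - INR M < s).
  { intros s; destruct (INR_unbounded (1 - s)) as [M HM]; exists M; lra. }
  set (N := fun s => proj1_sig (constructive_indefinite_description _ (HN s))).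
  assert (HNs : forall s, 1 - INR (N s) < s).
  { intros s; unfold N; destruct (constructive_indefinite_description _ _); auto. }
  clearbody N.
  assert (Hagree : forall M s, 1 - INR M < s -> F M s = F (N s) s).
  { intros M s Hs.
    apply (analytic_identity (Rmax (1 - INR M) (1 - INR (N s))) 1).
    - apply analytic_above_le with (1 - INR M); [apply Rmax_l|apply HF].
    - apply analytic_above_le with (1 - INR (N s)); [apply Rmax_r|apply HF].
    - intros t Ht; rewrite !(proj2 (HF _)); auto.
    - apply Rmax_lub_lt; auto. }
  exists (fun s => F (N s) s); split.
  - intros sigma; destruct (HN sigma) as [M HM].
    apply analytic_above_le with (1 - INR M); [lra|].
    apply analytic_above_ext with (F M); auto; apply HF.
  - intros s Hs; apply HF; auto.
Qed.

(** Splitting off the first term of the series replaces [a] by a + 1 > 1. *)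
Lemma reg_zeta_ex a : 0 < a -> exists F, is_reg_zeta a F.
Proof.
  intros Ha; destruct (reg_zeta_ex_gt1 (a + 1)) as [F [H1 H2]]; [lra|].
  exists (fun s => (-1 + 1 * s) * Rpower a (- s) + F s); split.
  - intros sigma; apply analytic_above_plus; auto; apply analytic_above_mult;
    [apply analytic_above_lin|apply analytic_Rpower].
  - intros s Hs; rewrite H2, (zser_shift a s) by auto; ring.
Qed.

(* [(s - 1) * zeta(s, a)], continued to all real [s]. *)
Definition reg_zeta (a : R) : R -> R := epsilon (inhabits (fun _ : R => 0)) (is_reg_zeta a).

Lemma reg_zeta_spec a : 0 < a -> is_reg_zeta a (reg_zeta a).
Proof. intros Ha; unfold reg_zeta; apply epsilon_spec, reg_zeta_ex, Ha. Qed.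

Lemma reg_zeta_analytic_all a : 0 < a -> analytic_all (reg_zeta a).
Proof. intros Ha; apply reg_zeta_spec, Ha. Qed.

Lemma reg_zeta_zser a s : 0 < a -> 1 < s -> reg_zeta a s = (s - 1) * zser a s.
Proof. intros Ha; apply (reg_zeta_spec a Ha). Qed.

(** Existence of a continuation makes the choice operator return one, and the identity theorem shows
    that every continuation has this value away from s = 1. *)
Lemma hurwitz_zeta_reg a s : 0 < a -> s <> 1 -> hurwitz_zeta a s = reg_zeta a s / (s - 1).
Proof.
  intros Ha Hs.
  assert (Hex : exists Z, hurwitz_cont a Z).
  { exists (fun s => reg_zeta a s / (s - 1)), (reg_zeta a); split; [|split].
    - apply analytic_all_real_analytic, reg_zeta_analytic_all, Ha.
    - intros t Ht; rewrite reg_zeta_zser by auto.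
      replace ((t - 1) * zser a t / (t - 1)) with (zser a t) by (field; lra).
      apply Series_correct, pseries_ex; auto.
    - intros t Ht; field; lra. }
  destruct (epsilon_spec (inhabits (fun _ : R => 0)) _ Hex) as [F [H1 [H2 H3]]].
  fold (hurwitz_zeta a) in H2, H3.
  assert (E : F s = reg_zeta a s).
  { apply (analytic_all_identity 1).
    - intros sigma; apply real_analytic_above, H1.
    - apply reg_zeta_analytic_all, Ha.
    - intros t Ht; rewrite H3 by lra; rewrite reg_zeta_zser by auto.
      f_equal; symmetry; apply is_series_unique, H2, Ht. }
  rewrite <- E, H3; auto; field; lra.
Qed.

Lemma hurwitz_zeta'_reg a s : 0 < a -> s <> 1 ->
  hurwitz_zeta' s a = Derive (reg_zeta a) s / (s - 1) - reg_zeta a s / (s - 1) ^ 2.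
Proof.
  intros Ha Hs; unfold hurwitz_zeta'.
  rewrite (Derive_ext_loc _ (fun t => reg_zeta a t / (t - 1))).
  - apply is_derive_unique.
    pose proof (analytic_all_ex_derive _ s (reg_zeta_analytic_all a Ha)) as Hd.
    auto_derive; [split; auto; split; auto; lra|].
    change (Derive (fun x => reg_zeta a x) s) with (Derive (reg_zeta a) s); field; lra.
  - assert (Hp : 0 < Rabs (s - 1)) by (apply Rabs_pos_lt; lra).
    exists (mkposreal _ Hp); intros t Ht; apply hurwitz_zeta_reg; auto.
    intros ->; change (Rabs (1 - s) < Rabs (s - 1)) in Ht.
    rewrite Rabs_minus_sym in Ht; lra.
Qed.

(** * Differentiability in a *)

(** Multiplied by s - 1, [zeta_rem_expand] becomes an identity between functions analytic for s > -
    (I + 1), so it extends from s > 1. The spelling [-1 + 1 * s] fits [analytic_above_lin]. *)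
Lemma reg_zeta_taylor I a y s : 0 < a -> Rabs y < a -> - INR (S I) < s ->
  (-1 + 1 * s) * zeta_rem (S I) a y s =
  reg_zeta (a + y) s - reg_zeta a s +
  sum_f_R0 (fun i => / INR (S i) * y ^ S i *
    ((-1 + 1 * s) * (bin (- s) i * reg_zeta a (s + INR (S i))))) I.
Proof.
  intros Ha Hy; pose proof (Rabs_def2 _ _ Hy); revert s.
  apply (analytic_identity (- INR (S I)) 1 (fun s => (-1 + 1 * s) * zeta_rem (S I) a y s)).
  - apply analytic_above_mult; [apply analytic_above_lin|apply analytic_zeta_rem; auto].
  - apply analytic_above_plus; [apply analytic_above_minus|apply analytic_above_sum].
    + apply reg_zeta_analytic_all; lra.
    + apply reg_zeta_analytic_all; lra.
    + intros i _; apply analytic_above_scal, analytic_above_mult; [apply analytic_above_lin|].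
      apply analytic_above_mult; [apply analytic_bin|].
      apply analytic_above_translate, reg_zeta_analytic_all; auto.
  - intros s Hs; rewrite zeta_rem_expand by auto.
    rewrite !reg_zeta_zser by lra.
    rewrite Rmult_plus_distr_l, scal_sum.
    f_equal; [ring|]; apply sum_eq; intros i _.
    rewrite reg_zeta_zser; auto; [unfold Rdiv; ring|].
    pose proof (lt_0_INR (S i) ltac:(lia)); lra.
Qed.

(** Serves for the terms of order at least 2 in the Taylor polynomial: for |y| <= 1 every power
    beyond the square is absorbed into the constant. *)
Lemma wiener_sum_pow2 s0 (g : nat -> R -> R) L : (forall i, analytic_all (g i)) ->
  exists rho C, 0 < rho /\ forall y, Rabs y <= 1 ->
    wiener s0 rho (fun s => sum_f_R0 (fun i => g i s * y ^ S (S i)) L) (C * y ^ 2).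
Proof.
  intros Hg.
  assert (Hterm : forall i, exists rho C, 0 < rho /\ forall y, Rabs y <= 1 ->
    wiener s0 rho (fun s => g i s * y ^ S (S i)) (C * y ^ 2)).
  { intros i; destruct (analytic_all_wiener _ s0 (Hg i)) as [r [C [Hr Hw]]].
    exists r, C; split; auto; intros y Hy.
    apply wiener_ext_all with (fun s => g i s * (y ^ S (S i) + 0 * s)); [intros; ring|].
    apply wiener_mult; auto; [|lra].
    eapply wiener_le; [|apply wiener_lin; lra].
    rewrite Rmult_0_l, Rplus_0_r, Rabs_R0, Rmult_0_l, Rplus_0_r.
    change (S (S i)) with (2 + i)%nat; rewrite pow_add, Rabs_mult.
    rewrite (Rabs_pos_eq (y ^ 2)) by apply pow2_ge_0.
    rewrite <- (Rmult_1_r (y ^ 2)) at 2; apply Rmult_le_compat_l; [apply pow2_ge_0|].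
    rewrite <- RPow_abs, <- (pow1 i); apply pow_incr; split; [apply Rabs_pos|auto]. }
  induction L as [|L [r1 [C1 [Hr1 H1]]]]; [apply Hterm|].
  destruct (Hterm (S L)) as [r2 [C2 [Hr2 H2]]].
  assert (Hm : 0 < Rmin r1 r2) by (apply Rmin_pos; auto).
  exists (Rmin r1 r2), (C1 + C2); split; auto; intros y Hy.
  rewrite Rmult_plus_distr_r; cbn [sum_f_R0]; apply wiener_plus; [| |lra].
  - apply wiener_shrink with r1; auto; split; [lra|apply Rmin_l].
  - apply wiener_shrink with r2; auto; split; [lra|apply Rmin_r].
Qed.

(** The key estimate: a norm bound, uniform in [y], on the remainder as a function of [s]. It yields
    the derivatives in [a] of both [reg_zeta] and its [s]-derivative. *)
Lemma reg_zeta_first_order a s0 : 0 < a ->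
  exists rho C d, 0 < rho /\ 0 < d /\ forall y, Rabs y <= d ->
    wiener s0 rho (fun s => reg_zeta (a + y) s - reg_zeta a s +
      (s - 1) * reg_zeta a (s + 1) * y) (C * y ^ 2).
Proof.
  intros Ha.
  (* With L > - s0 and a radius at most 1, the remainder of order L + 2 is analytic on the whole
     disc around [s0]. *)
  destruct (INR_unbounded (- s0)) as [L HL].
  set (g := fun i s => - / INR (S (S i)) *
    ((-1 + 1 * s) * (bin (- s) (S i) * reg_zeta a (s + INR (S (S i)))))).
  destruct (wiener_sum_pow2 s0 g L) as [r1 [C1 [Hr1 H1]]].
  { intros i sigma; unfold g; apply analytic_above_scal, analytic_above_mult;
    [apply analytic_above_lin|].
    apply analytic_above_mult; [apply analytic_bin|].
    apply analytic_above_translate, reg_zeta_analytic_all; auto. }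
  set (rho := Rmin r1 1).
  assert (Hrho : 0 < rho <= 1 /\ rho <= r1).
  { unfold rho; split; [split; [apply Rmin_pos; lra|apply Rmin_r]|apply Rmin_l]. }
  destruct (wiener_zeta_rem (S (S L)) a (1 / 2) s0 rho) as [C2 H2]; auto; try lra.
  { rewrite !S_INR; lra. }
  set (A := Rabs (-1 + 1 * s0) + Rabs 1 * rho).
  exists rho, (A * Rabs C2 + C1), (Rmin (a / 2) 1); split; [lra|split].
  { apply Rmin_pos; lra. }
  intros y Hy.
  assert (Hy1 : Rabs y <= 1) by (apply Rle_trans with (1 := Hy), Rmin_r).
  assert (Hya : Rabs y <= a / 2) by (apply Rle_trans with (1 := Hy), Rmin_l).
  apply wiener_ext with (fun s => (-1 + 1 * s) * zeta_rem (S (S L)) a y s +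
    sum_f_R0 (fun i => g i s * y ^ S (S i)) L).
  - intros s Hs.
    rewrite reg_zeta_taylor; auto; [|lra|].
    2:{ rewrite !S_INR; apply Rabs_le_between in Hs; lra. }
    rewrite decomp_sum by lia; simpl pred.
    replace (/ INR 1 * y ^ 1 * ((-1 + 1 * s) * (bin (- s) 0 * reg_zeta a (s + INR 1))))
      with ((s - 1) * reg_zeta a (s + 1) * y) by (simpl; field).
    match goal with |- ?p + (?q + ?u) + ?v = _ => enough (v = - u) by lra end.
    apply sum_eq_opp; intros i; unfold g; ring.
  - rewrite Rmult_plus_distr_r; apply wiener_plus; [| |lra].
    + rewrite Rmult_assoc; apply wiener_mult; [apply wiener_lin; lra| |lra].
      apply wiener_le with (2 := H2 y ltac:(lra)).
      rewrite (Rmult_comm (Rabs C2)).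
      apply Rle_trans with (Rabs y ^ S (S (S L)) * Rabs C2).
      * apply Rmult_le_compat_l; [apply pow_le, Rabs_pos|apply Rle_abs].
      * apply Rmult_le_compat_r; [apply Rabs_pos|].
        change (S (S (S L))) with (2 + S L)%nat; rewrite pow_add, pow2_abs.
        rewrite <- (Rmult_1_r (y ^ 2)) at 2; apply Rmult_le_compat_l; [apply pow2_ge_0|].
        rewrite <- (pow1 (S L)); apply pow_incr; split; [apply Rabs_pos|auto].
    + apply wiener_shrink with r1; auto; lra.
Qed.

Lemma is_derive_quadratic f a l C d : 0 < d ->
  (forall y, Rabs y <= d -> Rabs (f (a + y) - f a - l * y) <= C * y ^ 2) -> is_derive f a l.
Proof.
  intros Hd H.
  apply is_derive_Reals; intros eps He.
  assert (HC : 0 < Rabs C + 1) by (pose proof (Rabs_pos C); lra).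
  assert (Hm : 0 < Rmin d (eps / (Rabs C + 1))).
  { apply Rmin_pos; auto; apply Rdiv_lt_0_compat; auto. }
  exists (mkposreal _ Hm); intros y Hy Hlt; simpl in Hlt.
  assert (H1 : Rabs y <= d) by (left; apply Rlt_le_trans with (1 := Hlt), Rmin_l).
  assert (H2 : Rabs y < eps / (Rabs C + 1)) by (apply Rlt_le_trans with (1 := Hlt), Rmin_r).
  specialize (H y H1); pose proof (Rabs_pos_lt y Hy) as Hp.
  replace ((f (a + y) - f a) / y - l) with ((f (a + y) - f a - l * y) * / y) by (field; auto).
  rewrite Rabs_mult, Rabs_inv.
  apply Rmult_lt_reg_r with (Rabs y); auto; rewrite Rmult_assoc, Rinv_l, Rmult_1_r by lra.
  apply Rle_lt_trans with (1 := H).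
  rewrite <- (pow2_abs y); simpl; rewrite Rmult_1_r, <- Rmult_assoc.
  apply Rmult_lt_compat_r; auto.
  apply Rle_lt_trans with (Rabs C * Rabs y).
  { apply Rmult_le_compat_r; [lra|apply Rle_abs]. }
  apply Rle_lt_trans with ((Rabs C + 1) * Rabs y); [pose proof (Rabs_pos y); lra|].
  replace eps with ((Rabs C + 1) * (eps / (Rabs C + 1))) by (field; lra).
  apply Rmult_lt_compat_l; auto.
Qed.

Lemma is_derive_reg_zeta a s : 0 < a ->
  is_derive (fun a => reg_zeta a s) a (- ((s - 1) * reg_zeta a (s + 1))).
Proof.
  intros Ha; destruct (reg_zeta_first_order a s Ha) as [rho [C [d [Hr [Hd H]]]]].
  apply is_derive_quadratic with C d; auto; intros y Hy.
  eapply Rle_trans; [|apply (wiener_term_le s rho _ _ s ltac:(lra) (H y Hy))].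
  - right; f_equal; ring.
  - rewrite Rminus_diag, Rabs_R0; lra.
Qed.

(** Differentiating the first-order remainder in [s] gives the first-order remainder of the
    [s]-derivative, and [wiener_Derive] bounds it by (C / rho) y^2. Keeping |y| <= a / 2 ensures a +
    y > 0. *)
Lemma is_derive_reg_zeta' a s : 0 < a ->
  is_derive (fun a => Derive (reg_zeta a) s) a
    (- (reg_zeta a (s + 1) + (s - 1) * Derive (reg_zeta a) (s + 1))).
Proof.
  intros Ha; destruct (reg_zeta_first_order a s Ha) as [rho [C [d [Hr [Hd H]]]]].
  assert (Hm : 0 < Rmin d (a / 2)) by (apply Rmin_pos; lra).
  apply is_derive_quadratic with (C / rho) (Rmin d (a / 2)); auto; intros y Hy.
  assert (Hyd : Rabs y <= d) by (apply Rle_trans with (1 := Hy), Rmin_l).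
  assert (Hya : Rabs y <= a / 2) by (apply Rle_trans with (1 := Hy), Rmin_r).
  apply Rabs_le_between in Hya.
  destruct (wiener_Derive _ _ _ _ Hr (H y Hyd)) as [_ Hw].
  replace (C / rho * y ^ 2) with (C * y ^ 2 / rho) by (field; lra).
  eapply Rle_trans; [|exact Hw]; right; f_equal; symmetry.
  apply is_derive_unique.
  pose proof (analytic_all_ex_derive _ s (reg_zeta_analytic_all (a + y) ltac:(lra))) as H1.
  pose proof (analytic_all_ex_derive _ s (reg_zeta_analytic_all a Ha)) as H2.
  pose proof (analytic_all_ex_derive _ (s + 1) (reg_zeta_analytic_all a Ha)) as H3.
  auto_derive; [repeat split; auto|].
  change (Derive (fun x => reg_zeta (a + y) x) s) with (Derive (reg_zeta (a + y)) s).
  change (Derive (fun x => reg_zeta a x)) with (Derive (reg_zeta a)); ring.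
Qed.

(** * Duplication and the symmetrised zeta function *)

Lemma Series_even_odd (c : nat -> R) :
  ex_series c -> ex_series (fun n => c (2 * n)%nat) -> ex_series (fun n => c (2 * n + 1)%nat) ->
  Series c = Series (fun n => c (2 * n)%nat) + Series (fun n => c (2 * n + 1)%nat).
Proof.
  intros Hc H0 H1.
  assert (Hsub : is_lim_seq (fun N => sum_f_R0 c (2 * N + 1)) (Series c)).
  { apply (is_lim_seq_subseq (fun N => sum_f_R0 c N) _ (fun N => (2 * N + 1)%nat)).
    - apply eventually_subseq; intros n; lia.
    - apply is_lim_seq_Series; auto. }
  assert (Hsum : is_lim_seq (fun N => sum_f_R0 c (2 * N + 1))
    (Series (fun n => c (2 * n)%nat) + Series (fun n => c (2 * n + 1)%nat))).
  { apply is_lim_seq_ext with (fun N => sum_f_R0 (fun n => c (2 * n)%nat) N +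
      sum_f_R0 (fun n => c (2 * n + 1)%nat) N).
    - induction n as [|n IH]; [reflexivity|].
      replace (2 * S n + 1)%nat with (S (S (2 * n + 1))) by lia.
      cbn [sum_f_R0]; rewrite <- IH.
      replace (2 * S n)%nat with (S (2 * n + 1)) by lia.
      replace (S (2 * n + 1) + 1)%nat with (S (S (2 * n + 1))) by lia; ring.
    - apply is_lim_seq_plus'; apply is_lim_seq_Series; auto. }
  apply is_lim_seq_unique in Hsub; apply is_lim_seq_unique in Hsum.
  rewrite Hsub in Hsum; injection Hsum; auto.
Qed.

(** The series at 2 a is split by parity: n + 2 a is twice j + a for n = 2 j, and twice j + a + 1/2
    for n = 2 j + 1. *)
Lemma zser_duplication a s : 0 < a -> 1 < s ->
  zser a s + zser (a + 1 / 2) s = Rpower 2 s * zser (2 * a) s.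
Proof.
  intros Ha Hs; unfold zser.
  set (c := fun n => Rpower (INR n + 2 * a) (- s)).
  assert (H0 : forall n, c (2 * n)%nat = Rpower 2 (- s) * Rpower (INR n + a) (- s)).
  { intros n; pose proof (pos_INR n); unfold c.
    rewrite Rpower_mult_distr by lra; f_equal.
    rewrite mult_INR; simpl (INR 2); ring. }
  assert (H1 : forall n, c (2 * n + 1)%nat = Rpower 2 (- s) * Rpower (INR n + (a + 1 / 2)) (- s)).
  { intros n; pose proof (pos_INR n); unfold c.
    rewrite Rpower_mult_distr by lra; f_equal.
    rewrite plus_INR, mult_INR; simpl (INR 2); simpl (INR 1); field. }
  rewrite (Series_even_odd c).
  - rewrite (Series_ext _ _ H0), (Series_ext _ _ H1), !Series_scal_l.
    rewrite Rpower_Ropp; pose proof (Rpower_pos 2 s); field; lra.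
  - apply pseries_ex; lra.
  - apply ex_series_ext with (fun n => Rpower 2 (- s) * Rpower (INR n + a) (- s)); auto.
    apply (ex_series_scal_l (Rpower 2 (- s)) (fun n => Rpower (INR n + a) (- s))).
    apply pseries_ex; lra.
  - apply ex_series_ext with (fun n => Rpower 2 (- s) * Rpower (INR n + (a + 1 / 2)) (- s)); auto.
    apply (ex_series_scal_l (Rpower 2 (- s)) (fun n => Rpower (INR n + (a + 1 / 2)) (- s))).
    apply pseries_ex; lra.
Qed.

Lemma reg_zeta_duplication a s : 0 < a ->
  reg_zeta a s + reg_zeta (a + 1 / 2) s = Rpower 2 s * reg_zeta (2 * a) s.
Proof.
  intros Ha; revert s.
  apply (analytic_all_identity 1 (fun s => reg_zeta a s + reg_zeta (a + 1 / 2) s)).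
  - intros sigma; apply analytic_above_plus; apply reg_zeta_analytic_all; lra.
  - intros sigma; apply analytic_above_mult; [|apply reg_zeta_analytic_all; lra].
    apply analytic_above_ext with (fun s => Rpower (/ 2) (- s)); [|apply analytic_Rpower].
    intros s _; unfold Rpower; rewrite ln_Rinv by lra; f_equal; ring.
  - intros s Hs; rewrite !reg_zeta_zser by lra.
    pose proof (zser_duplication a s Ha Hs) as E; nra.
Qed.

(* [s - 1] times the continuation in [s] of [sum_{n in Z} |n + a|^(-s)]. *)
Definition sym_zeta (a s : R) : R := reg_zeta a s + reg_zeta (1 - a) s.
Definition sym_zeta' (a s : R) : R := Derive (reg_zeta a) s + Derive (reg_zeta (1 - a)) s.

(** The reflected terms come from duplication at 1/2 - a, positive because a < 1/2. *)
Lemma sym_zeta_duplication a s : 0 < a < 1 / 2 ->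
  sym_zeta a s + sym_zeta (a + 1 / 2) s = Rpower 2 s * sym_zeta (2 * a) s.
Proof.
  intros Ha; unfold sym_zeta.
  pose proof (reg_zeta_duplication a s ltac:(lra)) as H1.
  pose proof (reg_zeta_duplication (1 - (a + 1 / 2)) s ltac:(lra)) as H2.
  replace (1 - (a + 1 / 2) + 1 / 2) with (1 - a) in H2 by field.
  replace (2 * (1 - (a + 1 / 2))) with (1 - 2 * a) in H2 by field.
  rewrite Rmult_plus_distr_l, <- H1, <- H2; ring.
Qed.

Lemma is_derive_sym_zeta a s : 0 < a < 1 ->
  is_derive (fun s => sym_zeta a s) s (sym_zeta' a s).
Proof.
  intros Ha; apply (is_derive_plus (V := R_NormedModule) (reg_zeta a) (reg_zeta (1 - a)));
  apply Derive_correct, analytic_all_ex_derive, reg_zeta_analytic_all; lra.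
Qed.

(** Differentiating 2^s produces a term with factor ln 2, which the vanishing of [sym_zeta]
    removes. *)
Lemma sym_zeta'_duplication a s : 0 < a < 1 / 2 -> sym_zeta (2 * a) s = 0 ->
  sym_zeta' a s + sym_zeta' (a + 1 / 2) s = Rpower 2 s * sym_zeta' (2 * a) s.
Proof.
  intros Ha Hz.
  assert (H1 : is_derive (fun s => sym_zeta a s + sym_zeta (a + 1 / 2) s) s
    (sym_zeta' a s + sym_zeta' (a + 1 / 2) s)).
  { apply (is_derive_plus (V := R_NormedModule) (fun s => sym_zeta a s)
      (fun s => sym_zeta (a + 1 / 2) s)); apply is_derive_sym_zeta; lra. }
  assert (H2 : is_derive (fun s => Rpower 2 s * sym_zeta (2 * a) s) s
    (ln 2 * Rpower 2 s * sym_zeta (2 * a) s + Rpower 2 s * sym_zeta' (2 * a) s)).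
  { apply (is_derive_mult (K := R_AbsRing) (fun s => Rpower 2 s) (fun s => sym_zeta (2 * a) s)).
    - unfold Rpower; auto_derive; auto; ring.
    - apply is_derive_sym_zeta; lra.
    - intros; apply Rmult_comm. }
  assert (H3 : is_derive (fun s => sym_zeta a s + sym_zeta (a + 1 / 2) s) s
    (ln 2 * Rpower 2 s * sym_zeta (2 * a) s + Rpower 2 s * sym_zeta' (2 * a) s)).
  { revert H2; apply is_derive_ext; intros t; symmetry; apply sym_zeta_duplication; auto. }
  apply is_derive_unique in H1; apply is_derive_unique in H3.
  rewrite <- H1, H3, Hz; ring.
Qed.

Lemma is_derive_reflect (f : R -> R) a l :
  is_derive f (1 - a) l -> is_derive (fun a => f (1 - a)) a (- l).
Proof.
  intros H; replace (- l) with (-1 * l) by ring.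
  apply (is_derive_comp f (fun a => 1 - a)); auto.
  auto_derive; auto; ring.
Qed.

(** Like [sym_zeta'_da], odd under a -> 1 - a, hence zero at a = 1/2, the base point of every
    integration in [a]. *)
Definition sym_zeta_da (a s : R) : R :=
  - ((s - 1) * (reg_zeta a (s + 1) - reg_zeta (1 - a) (s + 1))).

Definition sym_zeta'_da (a s : R) : R :=
  - (reg_zeta a (s + 1) - reg_zeta (1 - a) (s + 1)) -
  (s - 1) * (Derive (reg_zeta a) (s + 1) - Derive (reg_zeta (1 - a)) (s + 1)).

Lemma is_derive_reg_zeta_reflect a s : a < 1 ->
  is_derive (fun a => reg_zeta (1 - a) s) a ((s - 1) * reg_zeta (1 - a) (s + 1)).
Proof.
  intros Ha.
  replace ((s - 1) * _) with (- - ((s - 1) * reg_zeta (1 - a) (s + 1))) by ring.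
  apply (is_derive_reflect (fun a => reg_zeta a s)), is_derive_reg_zeta; lra.
Qed.

Lemma is_derive_reg_zeta'_reflect a s : a < 1 ->
  is_derive (fun a => Derive (reg_zeta (1 - a)) s) a
    (reg_zeta (1 - a) (s + 1) + (s - 1) * Derive (reg_zeta (1 - a)) (s + 1)).
Proof.
  intros Ha.
  rewrite <- (Ropp_involutive (_ + _)).
  apply (is_derive_reflect (fun a => Derive (reg_zeta a) s)), is_derive_reg_zeta'; lra.
Qed.

Lemma is_derive_sym_zeta_a a s : 0 < a < 1 ->
  is_derive (fun a => sym_zeta a s) a (sym_zeta_da a s).
Proof.
  intros Ha; unfold sym_zeta_da.
  replace (- _) with (- ((s - 1) * reg_zeta a (s + 1)) + (s - 1) * reg_zeta (1 - a) (s + 1))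
    by ring.
  apply (is_derive_plus (V := R_NormedModule) (fun a => reg_zeta a s)
    (fun a => reg_zeta (1 - a) s)).
  - apply is_derive_reg_zeta; lra.
  - apply is_derive_reg_zeta_reflect; lra.
Qed.

Lemma is_derive_sym_zeta'_a a s : 0 < a < 1 ->
  is_derive (fun a => sym_zeta' a s) a (sym_zeta'_da a s).
Proof.
  intros Ha; unfold sym_zeta'_da.
  replace (_ - _) with (- (reg_zeta a (s + 1) + (s - 1) * Derive (reg_zeta a) (s + 1)) +
    (reg_zeta (1 - a) (s + 1) + (s - 1) * Derive (reg_zeta (1 - a)) (s + 1))) by ring.
  apply (is_derive_plus (V := R_NormedModule) (fun a => Derive (reg_zeta a) s)
    (fun a => Derive (reg_zeta (1 - a)) s)).
  - apply is_derive_reg_zeta'; lra.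
  - apply is_derive_reg_zeta'_reflect; lra.
Qed.

Lemma is_derive_sym_zeta_da a s : 0 < a < 1 ->
  is_derive (fun a => sym_zeta_da a s) a (s * (s - 1) * sym_zeta a (s + 2)).
Proof.
  intros Ha; unfold sym_zeta_da, sym_zeta.
  pose proof (is_derive_reg_zeta a (s + 1) ltac:(lra)) as H1.
  pose proof (is_derive_reg_zeta_reflect a (s + 1) ltac:(lra)) as H2.
  replace (s + 1 + 1) with (s + 2) in * by ring.
  evar_last.
  - apply (is_derive_opp (V := R_NormedModule)).
    apply (is_derive_scal
      (fun a => reg_zeta a (s + 1) - reg_zeta (1 - a) (s + 1))).
    apply (is_derive_minus (V := R_NormedModule) (fun a => reg_zeta a (s + 1))); eassumption.
  - unfold opp, scal, minus, plus; simpl; unfold opp, mult; simpl; ring.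
Qed.

(** The result is the [s]-derivative of s (s - 1) Psi(s + 2, a), by the product rule. *)
Lemma is_derive_sym_zeta'_da a s : 0 < a < 1 ->
  is_derive (fun a => sym_zeta'_da a s) a
    ((2 * s - 1) * sym_zeta a (s + 2) + s * (s - 1) * sym_zeta' a (s + 2)).
Proof.
  intros Ha; unfold sym_zeta'_da, sym_zeta, sym_zeta'.
  pose proof (is_derive_reg_zeta a (s + 1) ltac:(lra)) as H1.
  pose proof (is_derive_reg_zeta_reflect a (s + 1) ltac:(lra)) as H2.
  pose proof (is_derive_reg_zeta' a (s + 1) ltac:(lra)) as H3.
  pose proof (is_derive_reg_zeta'_reflect a (s + 1) ltac:(lra)) as H4.
  replace (s + 1 + 1) with (s + 2) in * by ring.
  evar_last.
  - apply (is_derive_minus (V := R_NormedModule)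
      (fun a => - (reg_zeta a (s + 1) - reg_zeta (1 - a) (s + 1)))).
    + apply (is_derive_opp (V := R_NormedModule)).
      apply (is_derive_minus (V := R_NormedModule) (fun a => reg_zeta a (s + 1))); eassumption.
    + apply (is_derive_scal
        (fun a => Derive (reg_zeta a) (s + 1) - Derive (reg_zeta (1 - a)) (s + 1))).
      apply (is_derive_minus (V := R_NormedModule) (fun a => Derive (reg_zeta a) (s + 1)));
      eassumption.
  - unfold opp, scal, minus, plus; simpl; unfold opp, mult; simpl; ring.
Qed.

(** * Integration from 1/2 and the zeros at s = - 2 k *)

Lemma derive_bound (f f1 : R -> R) (u v K : R) :
  (forall t, u <= t <= v -> is_derive f t (f1 t)) ->
  (forall t, u <= t <= v -> Rabs (f1 t) <= K) ->
  forall a b, u <= a <= v -> u <= b <= v -> Rabs (f a - f b) <= K * Rabs (a - b).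
Proof.
  intros Hd HK a b Ha Hb.
  destruct (MVT_gen f b a f1) as [c [Hc E]].
  - intros t Ht; apply Hd; unfold Rmin, Rmax in Ht; destruct (Rle_dec b a); lra.
  - intros t Ht; apply continuity_pt_filterlim, (ex_derive_continuous f).
    exists (f1 t); apply Hd; unfold Rmin, Rmax in Ht; destruct (Rle_dec b a); lra.
  - rewrite E, Rabs_mult; apply Rmult_le_compat_r; [apply Rabs_pos|apply HK].
    unfold Rmin, Rmax in Hc; destruct (Rle_dec b a); lra.
Qed.

(** Two applications of the mean value theorem starting from 1/2, where the first derivative
    vanishes; each costs a factor at most 1, the distances being at most 1. *)
Lemma second_derive_bound (f f1 f2 : R -> R) (d K : R) : 0 < d <= 1 / 2 -> 0 <= K ->
  (forall t, d <= t <= 1 - d -> is_derive f t (f1 t)) ->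
  (forall t, d <= t <= 1 - d -> is_derive f1 t (f2 t)) ->
  (forall t, d <= t <= 1 - d -> Rabs (f2 t) <= K) ->
  f1 (1 / 2) = 0 ->
  forall a, d <= a <= 1 - d -> Rabs (f a - f (1 / 2)) <= K.
Proof.
  intros Hd HK H1 H2 HK2 Hz a Ha.
  assert (Hb : forall t, d <= t <= 1 - d -> Rabs (t - 1 / 2) <= 1).
  { intros t Ht; apply Rabs_le; lra. }
  assert (HK1 : forall t, d <= t <= 1 - d -> Rabs (f1 t) <= K).
  { intros t Ht.
    pose proof (derive_bound f1 f2 d (1 - d) K H2 HK2 t (1 / 2) Ht ltac:(lra)) as H.
    rewrite Hz, Rminus_0_r in H; specialize (Hb t Ht).
    apply Rle_trans with (1 := H); rewrite <- (Rmult_1_r K) at 2.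
    apply Rmult_le_compat_l; auto. }
  apply Rle_trans with (1 := derive_bound f f1 d (1 - d) K H1 HK1 a (1 / 2) Ha ltac:(lra)).
  specialize (Hb a Ha); rewrite <- (Rmult_1_r K) at 2; apply Rmult_le_compat_l; auto.
Qed.

Lemma second_derive_zero (f f1 f2 : R -> R) :
  (forall t, 0 < t < 1 -> is_derive f t (f1 t)) ->
  (forall t, 0 < t < 1 -> is_derive f1 t (f2 t)) ->
  (forall t, 0 < t < 1 -> f2 t = 0) ->
  f1 (1 / 2) = 0 ->
  forall a, 0 < a < 1 -> f a = f (1 / 2).
Proof.
  intros H1 H2 H3 Hz a Ha.
  assert (Hm : 0 < Rmin a (1 - a) <= 1 / 2 /\ Rmin a (1 - a) <= a <= 1 - Rmin a (1 - a)).
  { unfold Rmin; destruct (Rle_dec a (1 - a)); lra. }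
  destruct Hm as [Hd Had].
  assert (H : Rabs (f a - f (1 / 2)) <= 0).
  { apply (second_derive_bound f f1 f2 (Rmin a (1 - a))); auto; try lra.
    - intros; apply H1; lra.
    - intros; apply H2; lra.
    - intros; rewrite H3, Rabs_R0; lra. }
  pose proof (Rabs_pos (f a - f (1 / 2))).
  apply Rminus_diag_uniq; destruct (Req_dec (f a - f (1 / 2)) 0) as [|Hn]; auto.
  apply Rabs_pos_lt in Hn; lra.
Qed.

Lemma one_minus_half : 1 - 1 / 2 = 1 / 2.
Proof. field. Qed.

Lemma Rpower_2_neg k : Rpower 2 (- (2 * INR k)) = / 2 ^ (2 * k).
Proof.
  rewrite Rpower_Ropp; f_equal.
  replace (2 * INR k) with (INR (2 * k)) by (rewrite mult_INR; simpl; ring).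
  apply Rpower_pow; lra.
Qed.

Lemma inv_pow2_le_1 n : 0 < / 2 ^ n <= 1.
Proof.
  pose proof (pow_R1_Rle 2 n ltac:(lra)).
  split; [apply Rinv_0_lt_compat; lra|].
  rewrite <- Rinv_1; apply Rinv_le_contravar; lra.
Qed.

Lemma sym_zeta_neg_even k a : 0 < a < 1 -> sym_zeta a (- (2 * INR k)) = 0.
Proof.
  revert a; induction k as [|k IH]; intros a Ha.
  all: match goal with |- sym_zeta _ ?t = 0 => set (s := t) end.
  all: assert (Hc : forall b, 0 < b < 1 -> sym_zeta b s = sym_zeta (1 / 2) s).
  1, 3: apply (second_derive_zero (fun a => sym_zeta a s) (fun a => sym_zeta_da a s)
      (fun a => s * (s - 1) * sym_zeta a (s + 2)));
    [intros; apply is_derive_sym_zeta_a; auto|intros; apply is_derive_sym_zeta_da; auto| |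
     unfold sym_zeta_da; rewrite one_minus_half; ring].
  (* The second derivative s (s - 1) Psi(s + 2, .) vanishes through its factor s = 0 in the base
     case, and through Psi(s + 2, .) = 0 in the induction step. *)
  1: intros t _; unfold s; simpl; ring.
  1: intros t Ht; unfold s; rewrite S_INR;
     replace (- (2 * (INR k + 1)) + 2) with (- (2 * INR k)) by ring; rewrite IH; auto; ring.
  (* If Psi(s, .) is a constant c, duplication at 1/4 reads 2 c = 2^s c; here 2^s <= 1, so c = 0. *)
  all: pose proof (sym_zeta_duplication (1 / 4) s ltac:(lra)) as E;
    replace (2 * (1 / 4)) with (1 / 2) in E by field;
    rewrite (Hc (1 / 4)), (Hc (1 / 4 + 1 / 2)) in E by lra;
    unfold s in E at 3; rewrite Rpower_2_neg in E.
  - pose proof (inv_pow2_le_1 (2 * 0)); rewrite Hc by auto; nra.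
  - pose proof (inv_pow2_le_1 (2 * S k)); rewrite Hc by auto; nra.
Qed.

(** * The value at s = 2 and the s-derivative at s = 0 *)

Lemma t_cos_le_sin t : 0 <= t <= PI / 2 -> t * cos t <= sin t.
Proof.
  intros Ht.
  destruct (MVT_gen (fun t => sin t - t * cos t) 0 t (fun t => t * sin t)) as [c [Hc E]].
  - intros u _; auto_derive; auto; ring.
  - intros u _; apply continuity_pt_filterlim, (ex_derive_continuous (fun t => sin t - t * cos t)).
    auto_derive; auto.
  - rewrite Rmin_left, Rmax_right in Hc by lra.
    assert (0 <= sin c) by (apply sin_ge_0; pose proof PI_RGT_0; lra).
    rewrite sin_0 in E.
    assert (0 <= c * sin c * (t - 0)).
    { apply Rmult_le_pos; [apply Rmult_le_pos|]; lra. }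
    lra.
Qed.

(** Isolates the double pole at 0. With t = pi a, squaring t cos t <= sin t gives t^2 - sin(t)^2 <=
    t^2 sin(t)^2, that is 1 / sin(t)^2 - 1 / t^2 <= 1. *)
Lemma inv_sin2_bound a : 0 < a <= 1 / 2 ->
  0 <= PI ^ 2 / sin (PI * a) ^ 2 - / a ^ 2 <= PI ^ 2.
Proof.
  intros Ha; pose proof PI_RGT_0.
  set (t := PI * a).
  assert (Ht : 0 < t <= PI / 2) by (unfold t; split; nra).
  assert (Hs : 0 < sin t) by (apply sin_gt_0; lra).
  assert (Hst : sin t < t) by (apply sin_lt_x; lra).
  assert (Hct : t * cos t <= sin t) by (apply t_cos_le_sin; lra).
  assert (Hc : 0 <= cos t) by (apply cos_ge_0; lra).
  pose proof (sin2_cos2 t) as E; unfold Rsqr in E.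
  replace a with (t / PI) by (unfold t; field; lra).
  assert (Hne : 0 < sin t ^ 2) by (apply pow_lt; auto).
  assert (Hnt : 0 < t ^ 2) by (apply pow_lt; lra).
  replace (PI ^ 2 / sin t ^ 2 - / (t / PI) ^ 2) with
    (PI ^ 2 * ((t ^ 2 - sin t ^ 2) / (sin t ^ 2 * t ^ 2))) by (field; repeat split; lra).
  assert (Hp : 0 < sin t ^ 2 * t ^ 2) by (apply Rmult_lt_0_compat; auto).
  assert (Hq : 0 <= (t ^ 2 - sin t ^ 2) / (sin t ^ 2 * t ^ 2) <= 1).
  { split.
    - apply Rmult_le_pos; [nra|left; apply Rinv_0_lt_compat; auto].
    - apply Rmult_le_reg_r with (sin t ^ 2 * t ^ 2); auto.
      unfold Rdiv; rewrite Rmult_assoc, Rinv_l by lra.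
      assert (Hsq : (t * cos t) ^ 2 <= sin t ^ 2).
      { apply pow_incr; split; auto; apply Rmult_le_pos; lra. }
      rewrite Rpow_mult_distr in Hsq.
      replace (cos t ^ 2) with (1 - sin t ^ 2) in Hsq by (rewrite <- E; ring).
      lra. }
  assert (0 < PI ^ 2) by (apply pow_lt; lra); nra.
Qed.

Lemma zser_2_bound a : 0 < a -> 0 <= zser a 2 - / a ^ 2 <= zser 1 2.
Proof.
  intros Ha; rewrite zser_shift by lra.
  replace (Rpower a (- (2))) with (/ a ^ 2).
  2:{ rewrite Rpower_Ropp; f_equal.
      symmetry; apply (Rpower_pow 2); auto. }
  assert (H1 : ex_series (fun n => Rpower (INR n + 1) (- (2)))) by (apply pseries_ex; lra).
  assert (H : 0 <= zser (a + 1) 2 <= zser 1 2); [|lra]; split.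
  - apply Rle_trans with (sum_f_R0 (fun n => Rpower (INR n + (a + 1)) (- (2))) 0).
    + left; apply Rpower_pos.
    + apply sum_le_Series; [intros; left; apply Rpower_pos|apply pseries_ex; lra].
  - apply Series_le; auto; intros n; split; [left; apply Rpower_pos|].
    rewrite !Rpower_Ropp; pose proof (pos_INR n).
    apply Rinv_le_contravar; [apply Rpower_pos|]; apply Rle_Rpower_l; lra.
Qed.

Lemma sym_zeta_2 a : 0 < a < 1 -> sym_zeta a 2 = zser a 2 + zser (1 - a) 2.
Proof. intros Ha; unfold sym_zeta; rewrite !reg_zeta_zser by lra; ring. Qed.

(** On (0, 1/2] the poles 1 / a^2 of both sides cancel, and the term 1 / (1 - a)^2 of the reflected
    series is at most 4. The other half follows by a -> 1 - a. *)
Lemma inv_sin2_sym_zeta_bound a : 0 < a < 1 ->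
  Rabs (PI ^ 2 / sin (PI * a) ^ 2 - sym_zeta a 2) <= PI ^ 2 + 4 + 2 * zser 1 2.
Proof.
  intros Ha.
  assert (H : forall b, 0 < b <= 1 / 2 ->
    Rabs (PI ^ 2 / sin (PI * b) ^ 2 - (zser b 2 + zser (1 - b) 2)) <= PI ^ 2 + 4 + 2 * zser 1 2).
  { intros b Hb.
    pose proof (inv_sin2_bound b Hb) as H1.
    pose proof (zser_2_bound b ltac:(lra)) as H2.
    pose proof (zser_2_bound (1 - b) ltac:(lra)) as H3.
    assert (H4 : 0 < / (1 - b) ^ 2 <= 4).
    { split; [apply Rinv_0_lt_compat, pow_lt; lra|].
      replace 4 with (/ (/ 4)) by field; apply Rinv_le_contravar; nra. }
    apply Rabs_le; lra. }
  rewrite sym_zeta_2 by auto; destruct (Rle_dec a (1 / 2)); [apply H; lra|].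
  specialize (H (1 - a) ltac:(lra)).
  replace (PI * (1 - a)) with (PI - PI * a) in H by ring; rewrite sin_PI_x in H.
  replace (1 - (1 - a)) with a in H by ring.
  rewrite Rplus_comm with (r1 := zser a 2); auto.
Qed.

(* Herglotz' trick: the difference of both sides is bounded, and the
   duplication formula halves any such bound. *)
Lemma sym_zeta_2_sin a : 0 < a < 1 -> sym_zeta a 2 = PI ^ 2 / sin (PI * a) ^ 2.
Proof.
  set (D := fun a => PI ^ 2 / sin (PI * a) ^ 2 - sym_zeta a 2).
  set (B := PI ^ 2 + 4 + 2 * zser 1 2).
  pose proof PI_RGT_0 as HPI.
  assert (Hdup : forall a, 0 < a < 1 -> D (a / 2) + D (a / 2 + 1 / 2) = 4 * D a).
  { intros b Hb; unfold D.
    pose proof (sym_zeta_duplication (b / 2) 2 ltac:(lra)) as E.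
    replace (2 * (b / 2)) with b in E by field.
    replace (Rpower 2 2) with 4 in E.
    2:{ symmetry; transitivity (2 ^ 2); [apply (Rpower_pow 2); lra|ring]. }
    assert (0 < b / 2 * PI < PI / 2) by (split; nra).
    assert (Hs : 0 < sin (PI * (b / 2))) by (apply sin_gt_0; lra).
    assert (Hc : 0 < cos (PI * (b / 2))) by (apply cos_gt_0; lra).
    replace (PI * (b / 2 + 1 / 2)) with (PI / 2 + PI * (b / 2)) by field.
    rewrite <- cos_sin.
    replace (PI * b) with (2 * (PI * (b / 2))) by field; rewrite sin_2a.
    replace (PI ^ 2 / (2 * sin (PI * (b / 2)) * cos (PI * (b / 2))) ^ 2) with
      ((PI ^ 2 / sin (PI * (b / 2)) ^ 2 + PI ^ 2 / cos (PI * (b / 2)) ^ 2) / 4).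
    - lra.
    - pose proof (sin2_cos2 (PI * (b / 2))) as E2; unfold Rsqr in E2.
      replace (PI ^ 2 / sin (PI * (b / 2)) ^ 2 + PI ^ 2 / cos (PI * (b / 2)) ^ 2) with
        (PI ^ 2 * (sin (PI * (b / 2)) * sin (PI * (b / 2)) +
          cos (PI * (b / 2)) * cos (PI * (b / 2))) /
          (sin (PI * (b / 2)) ^ 2 * cos (PI * (b / 2)) ^ 2)) by (field; lra).
      rewrite E2; field; lra. }
  assert (Hn : forall n a, 0 < a < 1 -> Rabs (D a) <= B * (1 / 2) ^ n).
  { induction n as [|n IH]; intros b Hb.
    - rewrite pow_O, Rmult_1_r; apply inv_sin2_sym_zeta_bound; auto.
    - pose proof (IH (b / 2) ltac:(lra)) as H1; pose proof (IH (b / 2 + 1 / 2) ltac:(lra)) as H2.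
      specialize (Hdup b Hb); simpl.
      apply Rabs_le_between in H1; apply Rabs_le_between in H2; apply Rabs_le; lra. }
  intros Ha.
  assert (H0 : Rbar_le (Rabs (D a)) 0).
  { apply (is_lim_seq_le (fun _ => Rabs (D a)) (fun n => B * (1 / 2) ^ n)).
    - intros n; apply Hn; auto.
    - apply is_lim_seq_const.
    - replace (Finite 0) with (Finite (B * 0)) by (f_equal; ring).
      apply is_lim_seq_mult'; [apply is_lim_seq_const|].
      apply is_lim_seq_geom; rewrite Rabs_pos_eq; lra. }
  simpl in H0; destruct (Req_dec (D a) 0) as [Hz|Hz]; [unfold D in Hz; lra|].
  apply Rabs_pos_lt in Hz; lra.
Qed.

Lemma sin_PI_pos a : 0 < a < 1 -> 0 < sin (PI * a).
Proof. intros Ha; pose proof PI_RGT_0; apply sin_gt_0; nra. Qed.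

(** At s = 0 the second derivative of [sym_zeta'] reduces to - Psi(2, a), which is that of ln(sin(pi
    a)). The constant on the right need not be computed: [fourier_error_normalize] disposes of
    it. *)
Lemma sym_zeta'_0 a : 0 < a < 1 ->
  sym_zeta' a 0 - ln (sin (PI * a)) = sym_zeta' (1 / 2) 0.
Proof.
  revert a.
  assert (H : forall a, 0 < a < 1 ->
    (fun a => sym_zeta' a 0 - ln (sin (PI * a))) a =
    (fun a => sym_zeta' a 0 - ln (sin (PI * a))) (1 / 2)).
  { apply (second_derive_zero (fun a => sym_zeta' a 0 - ln (sin (PI * a)))
      (fun a => sym_zeta'_da a 0 - PI * cos (PI * a) / sin (PI * a))
      (fun a => (2 * 0 - 1) * sym_zeta a (0 + 2) + 0 * (0 - 1) * sym_zeta' a (0 + 2)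
        - - (PI ^ 2 / sin (PI * a) ^ 2))).
    - intros t Ht; pose proof (sin_PI_pos t Ht).
      apply (is_derive_minus (V := R_NormedModule) (fun a => sym_zeta' a 0)
        (fun a => ln (sin (PI * a)))).
      + apply is_derive_sym_zeta'_a; auto.
      + auto_derive; auto; field; lra.
    - intros t Ht; pose proof (sin_PI_pos t Ht).
      apply (is_derive_minus (V := R_NormedModule) (fun a => sym_zeta'_da a 0)
        (fun a => PI * cos (PI * a) / sin (PI * a))).
      + apply is_derive_sym_zeta'_da; auto.
      + auto_derive; [lra|].
        pose proof (sin2_cos2 (PI * t)) as E; unfold Rsqr in E.
        replace (- (PI ^ 2 / sin (PI * t) ^ 2)) with
          (- (PI ^ 2 * (sin (PI * t) * sin (PI * t) + cos (PI * t) * cos (PI * t))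
            / sin (PI * t) ^ 2)) by (rewrite E; field; lra).
        field; lra.
    - intros t Ht; rewrite Rplus_0_l, sym_zeta_2_sin by auto; ring.
    - unfold sym_zeta'_da; rewrite one_minus_half.
      replace (PI * (1 / 2)) with (PI / 2) by field; rewrite cos_PI2, sin_PI2; field. }
  intros a Ha; cbv beta in H; rewrite H by auto.
  replace (PI * (1 / 2)) with (PI / 2) by field; rewrite sin_PI2, ln_1; ring.
Qed.

(** * Partial sums of the cosine series *)

Fixpoint cos_sum (k N : nat) (a : R) : R :=
  match N with
  | O => 0
  | S n => cos_sum k n a + cos (2 * PI * INR N * a) / INR N ^ (2 * k + 1)
  end.

Fixpoint cos_sum_da (k N : nat) (a : R) : R :=
  match N with
  | O => 0
  | S n => cos_sum_da k n a + - (2 * PI) * sin (2 * PI * INR N * a) / INR N ^ (2 * k)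
  end.

Lemma is_derive_cos_sum k N a : is_derive (cos_sum k N) a (cos_sum_da k N a).
Proof.
  induction N as [|N IH]; [apply (is_derive_const (V := R_NormedModule))|].
  cbn [cos_sum cos_sum_da].
  apply (is_derive_plus (V := R_NormedModule) (cos_sum k N)); auto.
  pose proof (lt_0_INR (S N) ltac:(lia)) as HN.
  set (c := INR (S N)) in *; clearbody c.
  rewrite pow_add, pow_1; pose proof (pow_lt c (2 * k) HN) as Hp.
  set (q := c ^ (2 * k)) in *; clearbody q.
  auto_derive; auto; field; lra.
Qed.

Lemma is_derive_cos_sum_da k N a :
  is_derive (cos_sum_da (S k) N) a (- (2 * PI) ^ 2 * cos_sum k N a).
Proof.
  induction N as [|N IH].
  - cbn [cos_sum]; rewrite Rmult_0_r; apply (is_derive_const (V := R_NormedModule)).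
  - cbn [cos_sum cos_sum_da]; rewrite Rmult_plus_distr_l.
    apply (is_derive_plus (V := R_NormedModule) (cos_sum_da (S k) N)); auto.
    pose proof (lt_0_INR (S N) ltac:(lia)) as HN.
    set (c := INR (S N)) in *; clearbody c.
    replace (2 * S k)%nat with (2 * k + 1 + 1)%nat by lia; rewrite pow_add, pow_1.
    pose proof (pow_lt c (2 * k + 1) HN) as Hp.
    set (q := c ^ (2 * k + 1)) in *; clearbody q.
    auto_derive; auto; field; lra.
Qed.

Lemma sin_cos_INR_PI n : sin (INR n * PI) = 0 /\ cos (INR n * PI) = (-1) ^ n.
Proof.
  induction n as [|n [IH1 IH2]].
  - simpl; rewrite Rmult_0_l, sin_0, cos_0; auto.
  - rewrite S_INR, Rmult_plus_distr_r, Rmult_1_l, neg_sin, neg_cos, IH1, IH2.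
    split; simpl; ring.
Qed.

Lemma cos_sum_da_half k N : cos_sum_da k N (1 / 2) = 0.
Proof.
  induction N as [|N IH]; auto; cbn [cos_sum_da]; rewrite IH.
  replace (2 * PI * INR (S N) * (1 / 2)) with (INR (S N) * PI) by field.
  rewrite (proj1 (sin_cos_INR_PI _)); unfold Rdiv; ring.
Qed.

(** Moving [a] by 1/2 multiplies the n-th cosine by (-1)^n: odd frequencies cancel and even ones
    double. The factor 2 / 2^(2 k + 1) remains, and 2 N terms become N. *)
Lemma cos_sum_duplication k N a :
  cos_sum k (2 * N) a + cos_sum k (2 * N) (a + 1 / 2) = / 2 ^ (2 * k) * cos_sum k N (2 * a).
Proof.
  induction N as [|N IH]; [simpl; ring|].
  replace (2 * S N)%nat with (S (S (2 * N))) by lia; cbn [cos_sum].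
  rewrite (Rmult_plus_distr_l (/ 2 ^ (2 * k))), <- IH.
  assert (Hshift : forall n, cos (2 * PI * INR n * (a + 1 / 2)) =
    (-1) ^ n * cos (2 * PI * INR n * a)).
  { intros n; replace (2 * PI * INR n * (a + 1 / 2)) with (2 * PI * INR n * a + INR n * PI)
      by field.
    rewrite cos_plus; destruct (sin_cos_INR_PI n) as [-> ->]; ring. }
  rewrite !Hshift.
  replace ((-1) ^ S (2 * N)) with (-1) by (rewrite <- tech_pow_Rmult, pow_1_even; ring).
  replace (S (S (2 * N))) with (2 * S N)%nat by lia; rewrite pow_1_even.
  assert (HI : INR (2 * S N) = 2 * INR (S N)) by (rewrite mult_INR; simpl (INR 2); ring).
  rewrite HI, Rpow_mult_distr.
  replace (2 * PI * INR (S N) * (2 * a)) with (2 * PI * (2 * INR (S N)) * a) by ring.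
  pose proof (lt_0_INR (S N) ltac:(lia)) as HN.
  pose proof (pow_lt _ (2 * k + 1) HN) as Hp.
  pose proof (pow_lt 2 (2 * k) ltac:(lra)) as H2.
  pose proof (pow_lt _ (2 * k + 1) (lt_0_INR (S (2 * N)) ltac:(lia))) as H3.
  rewrite (pow_add 2 (2 * k) 1), pow_1; field; lra.
Qed.

(** The conjugate Dirichlet kernel with its denominator cleared; with x = pi a it telescopes through
    2 sin(2 n x) sin x = cos((2 n - 1) x) - cos((2 n + 1) x). *)
Lemma sin_sum_closed N a :
  - cos_sum_da 0 N a * sin (PI * a) = PI * (cos (PI * a) - cos ((2 * INR N + 1) * (PI * a))).
Proof.
  induction N as [|N IH].
  - simpl; rewrite Rmult_0_r, Rplus_0_l, Rmult_1_l; ring.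
  - cbn [cos_sum_da]; rewrite Ropp_plus_distr, Rmult_plus_distr_r, IH, S_INR.
    change (2 * 0)%nat with 0%nat; rewrite pow_O.
    set (x := PI * a).
    replace (2 * PI * (INR N + 1) * a) with (2 * (INR N + 1) * x) by (unfold x; ring).
    replace ((2 * INR N + 1) * x) with (2 * (INR N + 1) * x - x) by ring.
    replace ((2 * (INR N + 1) + 1) * x) with (2 * (INR N + 1) * x + x) by ring.
    rewrite cos_plus, cos_minus; field.
Qed.

(** Uniformity is needed to integrate errors; the ends of (0, 1) are avoided because of the
    logarithmic singularity at k = 0. *)
Definition tends0_locally_uniformly (e : nat -> R -> R) : Prop :=
  forall d eps, 0 < d <= 1 / 2 -> 0 < eps ->
  exists N0, forall N, (N0 <= N)%nat -> forall a, d <= a <= 1 - d -> Rabs (e N a) < eps.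

Lemma sin_PI_lower d a : 0 < d <= 1 / 2 -> d <= a <= 1 - d -> sin (PI * d) <= sin (PI * a).
Proof.
  intros Hd Ha; pose proof PI_RGT_0 as HPI.
  assert (H : forall b, d <= b <= 1 / 2 -> sin (PI * d) <= sin (PI * b)).
  { intros b Hb; apply sin_incr_1; nra. }
  destruct (Rle_dec a (1 / 2)); [apply H; lra|].
  rewrite <- (sin_PI_x (PI * a)); replace (PI - PI * a) with (PI * (1 - a)) by ring; apply H; lra.
Qed.

(** By the kernel formula the derivative of the sum plus logarithm is pi cos(M pi a) / sin(pi a)
    with M = 2 N + 1. It oscillates without becoming small, so one integration by parts is used to
    gain the factor 1 / M. *)
Lemma cos_sum_log_sin :
  tends0_locally_uniformly (fun N a =>
    (cos_sum 0 N a + ln (sin (PI * a))) - (cos_sum 0 N (1 / 2) + ln (sin (PI * (1 / 2))))).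
Proof.
  intros d eps Hd He; pose proof PI_RGT_0 as HPI.
  set (sg := sin (PI * d)).
  assert (Hsg : 0 < sg) by (apply sin_PI_pos; lra).
  (* The first summand bounds M |f'| below, the second bounds M |g| at the two points [a] and
     1/2. *)
  set (K := PI / sg ^ 2 + 2 / sg).
  assert (HK : 0 < K).
  { apply Rplus_lt_0_compat; apply Rdiv_lt_0_compat; try lra; apply pow_lt; auto. }
  destruct (INR_unbounded (K / eps)) as [N0 HN0]; exists N0; intros N HN a Ha.
  assert (HNr : K / eps < INR N) by (apply Rlt_le_trans with (1 := HN0), le_INR; auto).
  set (M := 2 * INR N + 1).
  assert (HM : K / eps < M) by (pose proof (pos_INR N); unfold M; lra).
  assert (HM0 : 0 < M) by (pose proof (pos_INR N); unfold M; lra).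
  (* The boundary term of the integration by parts: subtracting it leaves a derivative of order 1 /
     M. *)
  set (g := fun a => sin (M * (PI * a)) / (M * sin (PI * a))).
  set (f := fun a => cos_sum 0 N a + ln (sin (PI * a)) - g a).
  assert (Hf : forall t, d <= t <= 1 - d -> is_derive f t
    (sin (M * (PI * t)) * (PI * cos (PI * t)) / (M * sin (PI * t) ^ 2))).
  { intros t Ht; pose proof (sin_PI_pos t ltac:(lra)) as Hs.
    evar_last.
    - apply (is_derive_minus (V := R_NormedModule) (fun a => cos_sum 0 N a + ln (sin (PI * a)))).
      + apply (is_derive_plus (V := R_NormedModule) (cos_sum 0 N)).
        * apply is_derive_cos_sum.
        * instantiate (1 := PI * cos (PI * t) / sin (PI * t)); auto_derive; auto; field; lra.
      + instantiate (1 := PI * cos (M * (PI * t)) / sin (PI * t) -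
          sin (M * (PI * t)) * (PI * cos (PI * t)) / (M * sin (PI * t) ^ 2)).
        unfold g; auto_derive; [apply Rmult_integral_contrapositive_currified; lra|field; lra].
    - change (cos_sum_da 0 N t + PI * cos (PI * t) / sin (PI * t) -
        (PI * cos (M * (PI * t)) / sin (PI * t) -
          sin (M * (PI * t)) * (PI * cos (PI * t)) / (M * sin (PI * t) ^ 2)) =
        sin (M * (PI * t)) * (PI * cos (PI * t)) / (M * sin (PI * t) ^ 2)).
      pose proof (sin_sum_closed N t) as E; fold M in E.
      replace (cos_sum_da 0 N t) with
        (- (PI * (cos (PI * t) - cos (M * (PI * t)))) / sin (PI * t)).
      + field; lra.
      + rewrite <- E; field; lra. }
  assert (Hfb : forall t, d <= t <= 1 - d ->
    Rabs (sin (M * (PI * t)) * (PI * cos (PI * t)) / (M * sin (PI * t) ^ 2)) <=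
    PI / sg ^ 2 / M).
  { intros t Ht; pose proof (sin_PI_lower d t Hd Ht) as Hl; fold sg in Hl.
    unfold Rdiv; rewrite !Rabs_mult, (Rabs_pos_eq PI) by lra.
    rewrite (Rabs_pos_eq (/ _)).
    2:{ left; apply Rinv_0_lt_compat, Rmult_lt_0_compat; auto; apply pow_lt; lra. }
    replace (PI * / sg ^ 2 * / M) with (PI * / (M * sg ^ 2)) by (field; lra).
    apply Rmult_le_compat.
    - apply Rmult_le_pos; [apply Rabs_pos|apply Rmult_le_pos; [lra|apply Rabs_pos]].
    - left; apply Rinv_0_lt_compat, Rmult_lt_0_compat; auto; apply pow_lt; lra.
    - assert (H1 : Rabs (sin (M * (PI * t))) <= 1) by (apply Rabs_le, SIN_bound).
      assert (H2 : Rabs (cos (PI * t)) <= 1) by (apply Rabs_le, COS_bound).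
      pose proof (Rabs_pos (sin (M * (PI * t)))); pose proof (Rabs_pos (cos (PI * t))).
      assert (Rabs (sin (M * (PI * t))) * Rabs (cos (PI * t)) <= 1) by nra; nra.
    - apply Rinv_le_contravar; [apply Rmult_lt_0_compat; auto; apply pow_lt; lra|].
      apply Rmult_le_compat_l; [lra|apply pow_incr; lra]. }
  assert (Hg : forall t, d <= t <= 1 - d -> Rabs (g t) <= / sg / M).
  { intros t Ht; pose proof (sin_PI_lower d t Hd Ht) as Hl; fold sg in Hl.
    unfold g, Rdiv; rewrite Rabs_mult, (Rabs_pos_eq (/ _)).
    2:{ left; apply Rinv_0_lt_compat, Rmult_lt_0_compat; lra. }
    replace (/ sg * / M) with (1 * / (sg * M)) by (field; lra).
    apply Rmult_le_compat; [apply Rabs_pos| |apply Rabs_le, SIN_bound|].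
    - left; apply Rinv_0_lt_compat, Rmult_lt_0_compat; lra.
    - rewrite (Rmult_comm sg); apply Rinv_le_contravar; [apply Rmult_lt_0_compat; lra|].
      apply Rmult_le_compat_l; lra. }
  pose proof (derive_bound f _ d (1 - d) _ Hf Hfb a (1 / 2) Ha ltac:(lra)) as Hab.
  assert (Hlen : Rabs (a - 1 / 2) <= 1) by (apply Rabs_le; lra).
  assert (Hpos : 0 <= PI / sg ^ 2 / M).
  { left; apply Rdiv_lt_0_compat; auto; apply Rdiv_lt_0_compat; auto; apply pow_lt; auto. }
  assert (Hab' : Rabs (f a - f (1 / 2)) <= PI / sg ^ 2 / M).
  { apply Rle_trans with (1 := Hab); rewrite <- (Rmult_1_r (PI / sg ^ 2 / M)) at 2.
    apply Rmult_le_compat_l; auto. }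
  pose proof (Hg a Ha) as Hg1; pose proof (Hg (1 / 2) ltac:(lra)) as Hg2.
  assert (HKM : K / M < eps).
  { apply Rmult_lt_reg_r with (M / eps); [apply Rdiv_lt_0_compat; auto|].
    replace (K / M * (M / eps)) with (K / eps) by (field; lra).
    replace (eps * (M / eps)) with M by (field; lra); auto. }
  replace (K / M) with (PI / sg ^ 2 / M + / sg / M + / sg / M) in HKM by (unfold K; field; lra).
  unfold f in Hab'.
  apply Rabs_le_between in Hab'; apply Rabs_le_between in Hg1; apply Rabs_le_between in Hg2.
  apply Rabs_def1; lra.
Qed.

(** * The Fourier expansion of the symmetrised derivative at s = - 2 k *)

Definition fourier_coef (k : nat) : R := (-1) ^ k * INR (fact (2 * k + 1)) / (2 * PI) ^ (2 * k).

(** The product (2 k + 2) (2 k + 3) is s (s - 1) at s = - 2 k - 2, and (2 pi)^2 comes from two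
    derivatives of a cosine; this is the relation that lets the errors at levels k + 1 and k
    match. *)
Lemma fourier_coef_S k :
  fourier_coef (S k) * (2 * PI) ^ 2 = - ((2 * INR k + 2) * (2 * INR k + 3)) * fourier_coef k.
Proof.
  unfold fourier_coef; pose proof PI_RGT_0.
  replace (2 * S k + 1)%nat with (S (S (2 * k + 1))) by lia.
  replace (2 * S k)%nat with (2 * k + 2)%nat by lia.
  rewrite !fact_simpl, !mult_INR, !S_INR, plus_INR, mult_INR, pow_add.
  pose proof (pow_lt (2 * PI) (2 * k) ltac:(lra)).
  simpl (INR 2); simpl (INR 1); cbn [pow]; field; lra.
Qed.

Definition fourier_error (k N : nat) (a : R) : R :=
  sym_zeta' a (- (2 * INR k)) + fourier_coef k * cos_sum k N a.

Lemma fourier_error_duplication k N a : 0 < a < 1 / 2 ->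
  fourier_error k (2 * N) a + fourier_error k (2 * N) (a + 1 / 2) =
  / 2 ^ (2 * k) * fourier_error k N (2 * a).
Proof.
  intros Ha; unfold fourier_error.
  pose proof (sym_zeta'_duplication a (- (2 * INR k)) Ha
    (sym_zeta_neg_even k (2 * a) ltac:(lra))) as E1.
  rewrite Rpower_2_neg in E1.
  pose proof (cos_sum_duplication k N a) as E2.
  rewrite Rmult_plus_distr_l, <- E1.
  replace (/ 2 ^ (2 * k) * (fourier_coef k * cos_sum k N (2 * a))) with
    (fourier_coef k * (/ 2 ^ (2 * k) * cos_sum k N (2 * a))) by ring.
  rewrite <- E2; ring.
Qed.

(** At a = 1/2 the cosines are (-1)^n, so Leibniz' criterion applies, also for k = 0. The sign of
    [l] is reversed because the alternating series is indexed from 0 and the cosine sum from 1. *)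
Lemma cos_sum_half_cv k : exists l : R, is_lim_seq (fun N => cos_sum k N (1 / 2)) l.
Proof.
  set (u := fun n => / INR (S n) ^ (2 * k + 1)).
  assert (Hpos : forall n, 0 < INR (S n)) by (intros n; apply lt_0_INR; lia).
  destruct (alternated_series u) as [l Hl].
  - intros n; unfold u; apply Rinv_le_contravar; [apply pow_lt; auto|].
    apply pow_incr; split; [left; auto|apply le_INR; lia].
  - apply is_lim_seq_Reals.
    apply is_lim_seq_le_le with (fun _ => 0) (fun n => / INR (S n)).
    + intros n; unfold u; split; [left; apply Rinv_0_lt_compat, pow_lt; auto|].
      apply Rinv_le_contravar; auto.
      rewrite pow_add, pow_1, <- (Rmult_1_l (INR (S n))) at 1.
      apply Rmult_le_compat_r; [left; auto|].
      apply pow_R1_Rle; rewrite S_INR; pose proof (pos_INR n); lra.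
    + apply is_lim_seq_const.
    + apply (is_lim_seq_incr_1 (fun n => / INR n)).
      replace (Finite 0) with (Rbar_inv p_infty) by reflexivity.
      apply is_lim_seq_inv; [apply is_lim_seq_INR|discriminate].
  - exists (- l); apply is_lim_seq_incr_1.
    apply is_lim_seq_ext with (fun N => - sum_f_R0 (tg_alt u) N).
    + assert (Hterm : forall n, cos (2 * PI * INR (S n) * (1 / 2)) / INR (S n) ^ (2 * k + 1) =
        - tg_alt u n).
      { intros n; replace (2 * PI * INR (S n) * (1 / 2)) with (INR (S n) * PI) by field.
        rewrite (proj2 (sin_cos_INR_PI _)); unfold tg_alt, u; simpl ((-1) ^ S n).
        unfold Rdiv; ring. }
      induction n as [|n IH].
      * cbn [sum_f_R0 cos_sum]; rewrite Hterm; ring.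
      * change (cos_sum k (S (S n)) (1 / 2)) with (cos_sum k (S n) (1 / 2) +
          cos (2 * PI * INR (S (S n)) * (1 / 2)) / INR (S (S n)) ^ (2 * k + 1)).
        rewrite Hterm, <- IH; cbn [sum_f_R0]; ring.
    + apply (is_lim_seq_opp (fun N => sum_f_R0 (tg_alt u) N) l), is_lim_seq_Reals; auto.
Qed.

(* The duplication formula forces the limit [e] at [1 / 2] to satisfy
   [2 e = 4^(-k) e]. *)
Lemma fourier_error_normalize k :
  tends0_locally_uniformly (fun N a => fourier_error k N a - fourier_error k N (1 / 2)) ->
  tends0_locally_uniformly (fourier_error k).
Proof.
  intros H.
  assert (Hcv : exists e : R, is_lim_seq (fun N => fourier_error k N (1 / 2)) e).
  { destruct (cos_sum_half_cv k) as [l Hl].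
    exists (sym_zeta' (1 / 2) (- (2 * INR k)) + fourier_coef k * l).
    apply is_lim_seq_plus'; [apply is_lim_seq_const|].
    apply is_lim_seq_mult'; auto; apply is_lim_seq_const. }
  destruct Hcv as [e He].
  pose proof (inv_pow2_le_1 (2 * k)) as Hq.
  assert (L1 : is_lim_seq (fun N => 2 * fourier_error k (2 * N) (1 / 2) -
    / 2 ^ (2 * k) * fourier_error k N (1 / 2)) (2 * e - / 2 ^ (2 * k) * e)).
  { apply is_lim_seq_minus'; (apply is_lim_seq_mult'; [apply is_lim_seq_const|]); auto.
    apply (is_lim_seq_subseq (fun N => fourier_error k N (1 / 2)) _ (fun N => (2 * N)%nat)); auto.
    apply eventually_subseq; intros n; lia. }
  (* A second limit of the same sequence: duplication at 1/4 replaces the last term by the errors at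
     1/4 and 3/4, which by hypothesis approach the error at 1/2. *)
  assert (L2 : is_lim_seq (fun N => 2 * fourier_error k (2 * N) (1 / 2) -
    / 2 ^ (2 * k) * fourier_error k N (1 / 2)) 0).
  { apply is_lim_seq_Reals; intros eps Heps.
    destruct (H (1 / 4) (eps / 2) ltac:(lra) ltac:(lra)) as [N0 HN0]; exists N0; intros N HN.
    pose proof (HN0 (2 * N)%nat ltac:(lia) (1 / 4) ltac:(lra)) as H1.
    pose proof (HN0 (2 * N)%nat ltac:(lia) (1 / 4 + 1 / 2) ltac:(lra)) as H2.
    pose proof (fourier_error_duplication k N (1 / 4) ltac:(lra)) as E.
    replace (2 * (1 / 4)) with (1 / 2) in E by field.
    unfold Rdist; rewrite <- E.
    apply Rabs_def2 in H1; apply Rabs_def2 in H2; apply Rabs_def1; lra. }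
  apply is_lim_seq_unique in L1; apply is_lim_seq_unique in L2.
  rewrite L2 in L1; apply (f_equal real) in L1; cbn [real] in L1.
  assert (He0 : e = 0) by (apply Rmult_eq_reg_l with (2 - / 2 ^ (2 * k)); lra); subst e.
  intros d eps Hd Heps.
  destruct (H d (eps / 2) Hd ltac:(lra)) as [N1 HN1].
  apply is_lim_seq_Reals in He; destruct (He (eps / 2) ltac:(lra)) as [N2 HN2].
  exists (N1 + N2)%nat; intros N HN a Ha.
  specialize (HN1 N ltac:(lia) a Ha); specialize (HN2 N ltac:(lia)).
  unfold Rdist in HN2; apply Rabs_def2 in HN1; apply Rabs_def2 in HN2; apply Rabs_def1; lra.
Qed.

(** At s = - 2 k - 2 the term with Psi(s + 2, .) vanishes, and the second derivative of the new
    error is [c] times the old one, with c = s (s - 1). Hence a bound eps / (2 c) at level k gives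
    eps / 2 at level k + 1, up to the value at 1/2. *)
Lemma fourier_error_step k :
  tends0_locally_uniformly (fourier_error k) ->
  tends0_locally_uniformly (fourier_error (S k)).
Proof.
  intros H; apply fourier_error_normalize; intros d eps Hd Heps.
  set (c := (2 * INR k + 2) * (2 * INR k + 3)).
  pose proof (pos_INR k) as Hk.
  assert (Hc : 0 < c) by (apply Rmult_lt_0_compat; lra).
  assert (He : 0 < eps / (2 * c)) by (apply Rdiv_lt_0_compat; lra).
  destruct (H d (eps / (2 * c)) Hd He) as [N0 HN0]; exists N0; intros N HN a Ha.
  apply Rle_lt_trans with (eps / 2); [|lra].
  set (s := - (2 * INR (S k))).
  assert (Hs : s + 2 = - (2 * INR k)) by (unfold s; rewrite S_INR; ring).
  apply (second_derive_bound (fourier_error (S k) N)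
    (fun a => sym_zeta'_da a s + fourier_coef (S k) * cos_sum_da (S k) N a)
    (fun a => (2 * s - 1) * sym_zeta a (s + 2) + s * (s - 1) * sym_zeta' a (s + 2) +
      fourier_coef (S k) * (- (2 * PI) ^ 2 * cos_sum k N a)) d); auto; [lra| | | |].
  - intros t Ht; unfold fourier_error; fold s.
    apply (is_derive_plus (V := R_NormedModule) (fun a => sym_zeta' a s)).
    + apply is_derive_sym_zeta'_a; lra.
    + apply is_derive_scal, is_derive_cos_sum.
  - intros t Ht.
    apply (is_derive_plus (V := R_NormedModule) (fun a => sym_zeta'_da a s)).
    + apply is_derive_sym_zeta'_da; lra.
    + apply is_derive_scal, is_derive_cos_sum_da.
  - intros t Ht; rewrite Hs, sym_zeta_neg_even by lra.
    pose proof (HN0 N HN t Ht) as Hb.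
    replace (_ + _) with (c * fourier_error k N t).
    + rewrite Rabs_mult, (Rabs_pos_eq c) by lra.
      replace (eps / 2) with (c * (eps / (2 * c))) by (field; lra).
      apply Rmult_le_compat_l; lra.
    + pose proof (fourier_coef_S k) as E; fold c in E.
      replace (fourier_coef (S k) * (- (2 * PI) ^ 2 * cos_sum k N t)) with
        (- (fourier_coef (S k) * (2 * PI) ^ 2) * cos_sum k N t) by ring.
      rewrite E; unfold fourier_error, s, c; rewrite S_INR; ring.
  - unfold sym_zeta'_da; rewrite one_minus_half, cos_sum_da_half; ring.
Qed.

Lemma fourier_error_tends0 k : tends0_locally_uniformly (fourier_error k).
Proof.
  induction k as [|k IH]; [|apply fourier_error_step, IH].
  apply fourier_error_normalize; intros d eps Hd Heps.
  (* At k = 0 the coefficient is 1 and [sym_zeta'_0] replaces [sym_zeta'] by ln(sin(pi a)) plus a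
     constant that drops out of the difference. *)
  destruct (cos_sum_log_sin d eps Hd Heps) as [N0 HN0]; exists N0; intros N HN a Ha.
  specialize (HN0 N HN a Ha).
  pose proof (sym_zeta'_0 a ltac:(lra)) as E1.
  pose proof (sym_zeta'_0 (1 / 2) ltac:(lra)) as E2.
  unfold fourier_error.
  replace (- (2 * INR 0)) with 0 by (simpl; ring).
  replace (fourier_coef 0) with 1 by (unfold fourier_coef; simpl; field).
  match goal with |- Rabs ?p < _ => match type of HN0 with Rabs ?q < _ =>
    replace p with q by lra end end; auto.
Qed.

Lemma cos_sum_lim k a : 0 < a < 1 ->
  is_lim_seq (fun N => cos_sum k N a) (- sym_zeta' a (- (2 * INR k)) / fourier_coef k).
Proof.
  intros Ha.
  assert (Hc : fourier_coef k <> 0).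
  { unfold fourier_coef; pose proof PI_RGT_0.
    repeat apply Rmult_integral_contrapositive_currified.
    - apply pow_nonzero; lra.
    - apply INR_fact_neq_0.
    - apply Rinv_neq_0_compat, pow_nonzero; lra. }
  assert (L : is_lim_seq (fun N => fourier_error k N a) 0).
  { apply is_lim_seq_Reals; intros eps Heps.
    assert (Hm : 0 < Rmin a (1 - a) <= 1 / 2 /\ Rmin a (1 - a) <= a <= 1 - Rmin a (1 - a)).
    { unfold Rmin; destruct (Rle_dec a (1 - a)); lra. }
    destruct (fourier_error_tends0 k _ eps (proj1 Hm) Heps) as [N0 HN0].
    exists N0; intros N HN; unfold Rdist; rewrite Rminus_0_r; apply HN0; auto; apply Hm. }
  apply is_lim_seq_ext with
    (fun N => (fourier_error k N a - sym_zeta' a (- (2 * INR k))) * / fourier_coef k).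
  { intros N; unfold fourier_error; field; auto. }
  replace (- sym_zeta' a (- (2 * INR k)) / fourier_coef k) with
    ((0 - sym_zeta' a (- (2 * INR k))) * / fourier_coef k) by (unfold Rdiv; ring).
  apply is_lim_seq_mult'; [|apply is_lim_seq_const].
  apply is_lim_seq_minus'; auto; apply is_lim_seq_const.
Qed.

(** * Odd frequencies and the final formula *)

(** The difference of cosines is 2 sin(n pi / 2) sin(n x): it vanishes for even n, and for n = 2 j +
    1 it carries the sign (-1)^j. The case split on [N] is there because [sum_f_R0] up to M has M +
    1 terms. *)
Lemma cos_sum_diff k x N :
  cos_sum k (2 * N) (1 / 4 - x / (2 * PI)) - cos_sum k (2 * N) (1 / 4 + x / (2 * PI)) =
  match N with
  | O => 0
  | S M => 2 * sum_f_R0 (fun n =>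
      (-1) ^ n * sin (INR (2 * n + 1) * x) / INR (2 * n + 1) ^ (2 * k + 1)) M
  end.
Proof.
  pose proof PI_RGT_0 as HPI.
  assert (Hprod : forall n, cos (2 * PI * INR n * (1 / 4 - x / (2 * PI))) -
    cos (2 * PI * INR n * (1 / 4 + x / (2 * PI))) = 2 * sin (INR n * (PI / 2)) * sin (INR n * x)).
  { intros n.
    replace (2 * PI * INR n * (1 / 4 - x / (2 * PI))) with (INR n * (PI / 2) - INR n * x)
      by (field; lra).
    replace (2 * PI * INR n * (1 / 4 + x / (2 * PI))) with (INR n * (PI / 2) + INR n * x)
      by (field; lra).
    rewrite cos_minus, cos_plus; ring. }
  induction N as [|N IH]; [simpl; ring|].
  replace (2 * S N)%nat with (S (S (2 * N))) by lia; cbn [cos_sum].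
  pose proof (Hprod (S (2 * N))) as H1; pose proof (Hprod (S (S (2 * N)))) as H2.
  replace (INR (S (S (2 * N))) * (PI / 2)) with (INR (S N) * PI) in H2.
  2:{ rewrite !S_INR, mult_INR; simpl (INR 2); field. }
  rewrite (proj1 (sin_cos_INR_PI _)) in H2.
  replace (INR (S (2 * N)) * (PI / 2)) with (PI / 2 + INR N * PI) in H1.
  2:{ rewrite S_INR, mult_INR; simpl (INR 2); field. }
  rewrite <- cos_sin, (proj2 (sin_cos_INR_PI _)) in H1.
  assert (Hsum : 2 * sum_f_R0 (fun n =>
      (-1) ^ n * sin (INR (2 * n + 1) * x) / INR (2 * n + 1) ^ (2 * k + 1)) N =
    match N with
    | O => 0
    | S M => 2 * sum_f_R0 (fun n =>
        (-1) ^ n * sin (INR (2 * n + 1) * x) / INR (2 * n + 1) ^ (2 * k + 1)) M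
    end + 2 * ((-1) ^ N * sin (INR (2 * N + 1) * x) / INR (2 * N + 1) ^ (2 * k + 1))).
  { destruct N; cbn [sum_f_R0]; ring. }
  rewrite Hsum, <- IH.
  replace (2 * N + 1)%nat with (S (2 * N)) by lia.
  unfold Rdiv in *.
  set (q1 := / INR (S (2 * N)) ^ (2 * k + 1)); set (q2 := / INR (S (S (2 * N))) ^ (2 * k + 1)).
  apply (f_equal (fun z => z * q1)) in H1; apply (f_equal (fun z => z * q2)) in H2; lra.
Qed.

Theorem mainTheorem7 (m : nat) (x : R) :
  (1 <= m)%nat -> - (PI / 2) < x < PI / 2 ->
  is_series
    (fun n : nat =>
       (-1) ^ n * sin (INR (2 * n + 1) * x) / INR (2 * n + 1) ^ (2 * m - 1))
    ((-1) ^ (m - 1) * (2 * PI) ^ (2 * m - 2) / (2 * INR (Factorial.fact (2 * m - 2))) *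
     (hurwitz_zeta' (2 - 2 * INR m) (1 / 4 - x / (2 * PI))
      - hurwitz_zeta' (2 - 2 * INR m) (3 / 4 - x / (2 * PI))
      - hurwitz_zeta' (2 - 2 * INR m) (1 / 4 + x / (2 * PI))
      + hurwitz_zeta' (2 - 2 * INR m) (3 / 4 + x / (2 * PI)))).
Proof.
  intros Hm Hx; destruct m as [|k]; [lia|clear Hm].
  pose proof PI_RGT_0 as HPI; pose proof (pos_INR k) as Hk.
  replace (S k - 1)%nat with k by lia.
  replace (2 * S k - 2)%nat with (2 * k)%nat by lia.
  replace (2 * S k - 1)%nat with (2 * k + 1)%nat by lia.
  replace (2 - 2 * INR (S k)) with (- (2 * INR k)) by (rewrite S_INR; ring).
  set (s := - (2 * INR k)).
  set (y := x / (2 * PI)).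
  assert (Hy : - (1 / 4) < y < 1 / 4).
  { unfold y; split; apply Rmult_lt_reg_r with (2 * PI); try lra;
    replace (x / (2 * PI) * (2 * PI)) with x by (field; lra); lra. }
  set (al := 1 / 4 - y); set (be := 1 / 4 + y).
  (* The four arguments form two pairs exchanged by a -> 1 - a, so only symmetrised derivatives are
     needed. *)
  replace (3 / 4 - y) with (1 - be) by (unfold be; field).
  replace (3 / 4 + y) with (1 - al) by (unfold al; field).
  assert (Hal : 0 < al < 1) by (unfold al; lra).
  assert (Hbe : 0 < be < 1) by (unfold be; lra).
  (* The quotient rule for division by s - 1 = - (2 k + 1) also yields a multiple of [sym_zeta a s],
     which is zero at s = - 2 k. *)
  assert (Hsym : forall a, 0 < a < 1 ->
    hurwitz_zeta' s a + hurwitz_zeta' s (1 - a) = - sym_zeta' a s / (2 * INR k + 1)).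
  { intros a Ha; rewrite !hurwitz_zeta'_reg by (unfold s; lra).
    pose proof (sym_zeta_neg_even k a Ha) as Hz; fold s in Hz.
    transitivity (sym_zeta' a s / (s - 1) - sym_zeta a s / (s - 1) ^ 2).
    - unfold sym_zeta, sym_zeta'; field; unfold s; lra.
    - rewrite Hz; unfold s; field; lra. }
  pose proof (Hsym al Hal) as Ea; pose proof (Hsym be Hbe) as Eb.
  assert (L : is_lim_seq (fun M => / 2 *
      (cos_sum k (2 * S M) al - cos_sum k (2 * S M) be))
    (/ 2 * (- sym_zeta' al s / fourier_coef k - - sym_zeta' be s / fourier_coef k))).
  { apply is_lim_seq_mult'; [apply is_lim_seq_const|].
    assert (Hsub : forall a, 0 < a < 1 -> is_lim_seq (fun M => cos_sum k (2 * S M) a)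
      (- sym_zeta' a s / fourier_coef k)).
    { intros a Ha.
      apply (is_lim_seq_subseq (fun N => cos_sum k N a) _ (fun M => (2 * S M)%nat)).
      - apply eventually_subseq; intros n; lia.
      - apply cos_sum_lim; auto. }
    apply is_lim_seq_minus'; auto. }
  apply is_series_lim.
  match goal with |- is_lim_seq _ (Finite ?l) =>
    replace l with
      (/ 2 * (- sym_zeta' al s / fourier_coef k - - sym_zeta' be s / fourier_coef k)) end.
  - apply is_lim_seq_ext with (2 := L); intros M.
    unfold al, be, y; rewrite cos_sum_diff; field.
  - match goal with |- _ = ?c * ?h => replace h with
      (- sym_zeta' al s / (2 * INR k + 1) - - sym_zeta' be s / (2 * INR k + 1)) by lra end.
    unfold fourier_coef.
    replace (2 * k + 1)%nat with (S (2 * k)) by lia.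
    (* The factor 2 k + 1 of (2 k + 1)! cancels the one from s - 1, leaving (2 k)! in the
       denominator. *)
    rewrite fact_simpl, mult_INR, S_INR, mult_INR; simpl (INR 2).
    pose proof (INR_fact_neq_0 (2 * k)) as Hf.
    pose proof (pow_nonzero (2 * PI) (2 * k) ltac:(lra)) as Hp.
    assert (Hsgn : (-1) ^ k * (-1) ^ k = 1) by (rewrite <- Rpow_mult_distr;
      replace (-1 * -1) with 1 by ring; apply pow1).
    assert (Hn : (-1) ^ k <> 0) by (apply pow_nonzero; lra).
    (* The limit has (-1)^k in a denominator, through [fourier_coef]; the sign is its own
       inverse. *)
    replace ((-1) ^ k * (2 * PI) ^ (2 * k) / (2 * INR (fact (2 * k)))) with
      (/ (-1) ^ k * (2 * PI) ^ (2 * k) / (2 * INR (fact (2 * k)))).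
    + field; repeat split; auto; lra.
    + f_equal; f_equal.
      apply Rmult_eq_reg_l with ((-1) ^ k); auto; rewrite Hsgn; field; auto.
Qed.
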